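(* Let $(k_n)_n$ be a sparsity sequence with $k_n\in[1,n/2)$. (i) If $k_n\gg n/\log(n)$, there exists no (sequence of) multiple testing procedures $(R_\alpha)_{\alpha\in(0,1)}$ that is AMO (for $k_n$). (ii) If $k_n\ll n/\log(n)$, the sequence of plug-in BH procedures $(\mathrm{BH}_\alpha(\widetilde\theta,\widetilde\sigma))_{\alpha\in(0,1)}$ is AMO (for $k_n$), where $\widetilde\theta=Y_{(\lceil n/2\rceil)}$ and $\widetilde\sigma=U_{(\lceil n/2\rceil)}/\overline\Phi^{-1}(1/4)$ with $U_i=|Y_i-Y_{(\lceil n/2\rceil)}|$.
   Context: Notation: $u_n\gg v_n$ (or $v_n\ll u_n$) means $v_n=o(u_n)$; $x\vee y=\max(x,y)$; $\overline\Phi$ is the upper tail function of $\mathcal N(0,1)$; $v_{(i)}$ is the $i$-th smallest entry of a vector $v$. Setting. One observes $Y=(Y_1,\dots,Y_n)$ with independent real coordinates, $Y_i\sim P_i$, and $P=\otimes_{i=1}^nP_i$ is the law of $Y$. $\mathcal P$ is the set of all such product distributions $P$ on $\mathbb R^n$ for which there exists $(\theta,\sigma)\in\mathbb R\times(0,\infty)$ with $|\{i: P_i=\mathcal N(\theta,\sigma^2)\}|>n/2$; this couple is unique and denoted $(\theta(P),\sigma(P))$. Let $\mathcal H_0(P)=\{i: P_i=\mathcal N(\theta(P),\sigma(P)^2)\}$ (true nulls), $n_0(P)=|\mathcal H_0(P)|$, $\mathcal H_1(P)$ the complement of $\mathcal H_0(P)$ in $\{1,\dots,n\}$, $n_1(P)=|\mathcal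 H_1(P)|$. (All these objects depend on $n$.) A multiple testing procedure is a measurable map $R$ from the data $Y$ to subsets $R(Y)\subset\{1,\dots,n\}$ (rejected hypotheses). Set $$\mathrm{FDP}(P,R(Y))=\frac{|R(Y)\cap\mathcal H_0(P)|}{|R(Y)|\vee1},\quad \mathrm{FDR}(P,R)=\mathbb E_{Y\sim P}[\mathrm{FDP}(P,R(Y))],\quad \mathrm{TDP}(P,R(Y))=\frac{|R(Y)\cap\mathcal H_1(P)|}{n_1(P)\vee1}.$$ Plug-in BH. For $u\in\mathbb R$, $s>0$, let $p_i(u,s)=2\overline\Phi(|Y_i-u|/s)$, $T_\alpha(Y;u,s)=\max\{t\in[0,1]:\sum_{i=1}^n\mathbf 1\{p_i(u,s)\le t\}\ge nt/\alpha\}$ and $\mathrm{BH}_\alpha(u,s)=\mathrm{BH}_\alpha(Y;u,s)=\{i: p_i(u,s)\le T_\alpha(Y;u,s)\}$. The oracle BH procedure is $\mathrm{BH}^*_\alpha=\mathrm{BH}_\alpha(Y;\theta(P),\sigma(P))$. Risks: $\mathbf I(R,k)=\sup_{P\in\mathcal P,\,n_1(P)\le k}\mathrm{FDR}(P,R)$ and $\mathbf{II}(R,k,\alpha)=\sup_{P\in\mathcal P,\,n_1(P)\le k}\mathbb P_{Y\sim P}\big(\mathrm{TDP}(P,R)<\mathrm{TDP}(P,\mathrm{BH}^*_\alpha)\big)$. AMO. For a sparsity sequence $k_n\in[1,n/2)$, a sequence of procedures $R=(R_\alpha)_{\alpha\in(0,1)}$ (depending on $n$ and on the nominal level $\alpha$)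 is AMO (asymptotically mimicking the oracle BH procedure) if there exists a positive sequence $\eta_n\to0$ such that both $$\limsup_n\sup_{\alpha\in(1/n,1/2)}\{\mathbf I(R_\alpha,k_n)-\alpha\}\le0,\qquad \lim_n\sup_{\alpha\in(1/n,1/2)}\mathbf{II}(R_\alpha,k_n,\alpha(1-\eta_n))=0 .$$ *)

(* Defs.v *)
From HB Require Import structures.
From mathcomp Require Import all_boot all_order all_algebra.
From mathcomp Require Import all_classical all_reals all_analysis.

Set Implicit Arguments.
Unset Strict Implicit.
Unset Printing Implicit Defensive.

Import Order.TTheory GRing.Theory Num.Theory.
Import numFieldNormedType.Exports.

Local Open Scope classical_set_scope.
Local Open Scope ring_scope.

Section product_law.
Context d (T : measurableType d) (R : realType).

Definition tuple_cons n (z : T * n.-tuple T) : n.+1.-tuple T :=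
  [tuple of z.1 :: z.2].

Lemma measurable_tuple_cons n : measurable_fun setT (@tuple_cons n).
Proof. exact: measurable_cons. Qed.

HB.instance Definition _ n :=
  isMeasurableFun.Build _ _ _ _ (@tuple_cons n) (@measurable_tuple_cons n).

Fixpoint product_law n :
    ('I_n -> probability T R) -> probability (n.-tuple T) R :=
  match n with
  | 0 => fun _ => \d_ ([tuple] : 0.-tuple T)
  | m.+1 => fun P =>
      distribution (P ord0 \x product_law (fun i => P (lift ord0 i)))%E
                   (@tuple_cons m)
  end.

(* This property characterizes product_law P among the measures on
   n.-tuple T: under it the coordinates are independent, with laws P i. *)
Lemma product_lawE n (P : 'I_n -> probability T R) (B : 'I_n -> set T) :
  (forall i, measurable (B i)) ->
  product_law P [set y | forall i, B i (tnth y i)] = (\prod_(i < n) P i (B i))%E.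
Proof.
elim: n => [|n IH] in P B * => mB.
  rewrite big_ord0 /= diracE mem_set//=.
  by case.
rewrite /= /distribution /pushforward big_ord_recl.
rewrite -(IH _ (fun i => B (lift ord0 i))); last by move=> i; exact: mB.
rewrite -product_measure1E//; last first.
  rewrite (_ : [set y | _] = \bigcap_(i in [set: 'I_n])
      ((fun y => tnth y i) @^-1` B (lift ord0 i))); last first.
    by apply/seteqP; split => y /= yB i => [_|]; exact: yB.
  apply: fin_bigcap_measurable => // i _.
  by rewrite -[X in measurable X]setTI; exact: measurable_tnth.
congr (_ _); apply/seteqP; split => -[x y] /= H.
  split; first by have := H ord0; rewrite /tuple_cons tnth0.
  by move=> i; have := H (lift ord0 i); rewrite /tuple_cons tnthS.
case: H => H0 HS i; rewrite /tuple_cons.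
by have [j ->|->] := unliftP ord0 i; rewrite ?tnthS ?tnth0.
Qed.

End product_law.

Section model.
Context {R : realType} (n : nat).

Definition observation : Type := n.-tuple (measurableTypeR R).

Definition marginals : Type := 'I_n -> probability (measurableTypeR R) R.

Implicit Types (P : marginals) (Y : observation).

Definition has_normal_law (Q : probability (measurableTypeR R) R) (m s : R) :=
  forall A : set (measurableTypeR R), measurable A -> Q A = normal_prob m s A.

Definition normal_coords P (m s : R) : {set 'I_n} :=
  finset (fun i => `[< has_normal_law (P i) m s >]).

Definition is_null_param P (p : R * R) :=
  0 < p.2 /\ (n < 2 * #|normal_coords P p.1 p.2|)%N.

Definition model : set marginals :=
  [set P | exists p : R * R, is_null_param P p].

(* The choice is unambiguous for P in the model: two majorities share a
   coordinate, whose law determines the couple.  Outside of the model the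
   couple (0, 1) is a dummy. *)
Definition null_param P : R * R := xget (0, 1) (is_null_param P).
Definition theta P : R := (null_param P).1.
Definition sigma P : R := (null_param P).2.

Definition H0 P : {set 'I_n} := normal_coords P (theta P) (sigma P).
Definition H1 P : {set 'I_n} := ~: H0 P.

Definition sparse_model (k : R) : set marginals :=
  [set P | model P /\ #|H1 P|%:R <= k].

Definition procedure (r : observation -> {set 'I_n}) :=
  forall S : {set 'I_n}, measurable (r @^-1` [set S]).

Definition FDP P (S : {set 'I_n}) : R :=
  #|S :&: H0 P|%:R / (maxn #|S| 1)%:R.

Definition TDP P (S : {set 'I_n}) : R :=
  #|S :&: H1 P|%:R / (maxn #|H1 P| 1)%:R.

Definition FDR P (r : observation -> {set 'I_n}) : \bar R :=
  'E_(product_law P)[fun Y => FDP P (r Y)].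

Definition normal_tail (x : R) : R := fine (normal_prob 0 1 `]x, +oo[).

Definition pvalue Y (u s : R) (i : 'I_n) : R :=
  2 * normal_tail (`|tnth Y i - u| / s).

Definition BH_levels (a : R) Y (u s : R) : set R :=
  [set t | 0 <= t <= 1 /\
           n%:R * t / a <= \sum_(i < n) (pvalue Y u s i <= t)%R%:R].

Definition BH_threshold (a : R) Y (u s : R) : R := sup (BH_levels a Y u s).

Lemma BH_threshold_max a Y u s : 0 < a ->
  BH_levels a Y u s (BH_threshold a Y u s) /\
  ubound (BH_levels a Y u s) (BH_threshold a Y u s).
Proof.
move=> a0; set L := BH_levels a Y u s; set T := BH_threshold a Y u s.
have L0 : L 0.
  rewrite /L /BH_levels/= lexx ler01 mulr0 mul0r; split => //.
  by apply: sumr_ge0 => i _; exact: ler0n.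
have L1 : ubound L 1 by move=> t [/andP[]].
have supL : has_sup L by split; [exists 0|exists 1].
have ubT : ubound L T by move=> t Lt; exact: (ub_le_sup (proj2 supL) Lt).
split => //.
have T0 : 0 <= T by exact: ubT.
have T1 : T <= 1 by apply: ge_sup => //; exists 0.
split; first by rewrite T0 T1.
set N := (X in _ <= X).
have NE t : L t -> n%:R * t <= N * a.
  move=> Lt; case: (Lt) => _; rewrite ler_pdivrMr// => /le_trans; apply.
  rewrite ler_wpM2r ?(ltW a0)//; apply: ler_sum => i _.
  rewrite ler_nat; case: (lerP (pvalue Y u s i) t) => //= ?.
  by rewrite (le_trans _ (ubT _ Lt)).
rewrite ler_pdivrMr//; have [->|n0] := posnP n.
  by rewrite mul0r mulr_ge0 ?(ltW a0)//; apply: sumr_ge0 => i _; exact: ler0n.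
rewrite mulrC -ler_pdivlMr ?ltr0n//.
apply: ge_sup; first by exists 0.
by move=> t Lt; rewrite ler_pdivlMr ?ltr0n// mulrC; exact: NE.
Qed.

Definition BH (a : R) Y (u s : R) : {set 'I_n} :=
  finset (fun i => pvalue Y u s i <= BH_threshold a Y u s).

Definition oracle_BH P (a : R) Y : {set 'I_n} := BH a Y (theta P) (sigma P).

Definition risk_I (r : observation -> {set 'I_n}) (k : R) : \bar R :=
  ereal_sup [set FDR P r | P in sparse_model k].

Definition risk_II (r : observation -> {set 'I_n}) (k a : R) : \bar R :=
  ereal_sup
    [set product_law P [set Y | TDP P (r Y) < TDP P (oracle_BH P a Y)]
    | P in sparse_model k].

(* Entries are counted from 1, unlike in nth. *)
Definition order_stat (v : seq R) (i : nat) : R := nth 0 (sort <=%R v) i.-1.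

(* uphalf n is n / 2 rounded up, so the median of an even number of entries is
   the lower one. *)
Definition median (v : seq R) : R := order_stat v (uphalf (size v)).

Definition theta_est Y : R := median Y.

Definition normal_tail_inv (p : R) : R := xget 0 [set x | normal_tail x = p].

Definition sigma_est Y : R :=
  median [seq `|y - theta_est Y| | y : R <- Y] / normal_tail_inv (1 / 4).

Definition plugin_BH (a : R) Y : {set 'I_n} :=
  BH a Y (theta_est Y) (sigma_est Y).

End model.

Arguments observation R n : clear implicits.
Arguments plugin_BH {R} n.

Section AMO.
Context {R : realType}.

Definition sparsity_sequence (k : nat -> R) :=
  forall n, (2 < n)%N -> 1 <= k n < n%:R / 2.

Definition AMO (k : nat -> R)
    (r : forall n, R -> observation R n -> {set 'I_n}) : Prop :=
  (forall n a, 0 < a < 1 -> procedure (r n a)) /\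
  exists eta : nat -> R,
    [/\ forall n, 0 < eta n,
        eta @ \oo --> 0,
        (limn_esup (fun n =>
           ereal_sup [set risk_I (r n a) (k n) - a%:E
                     | a in [set a : R | (n%:R^-1 < a < 2^-1)%R]]) <= 0)%E &
        (fun n =>
           ereal_sup [set risk_II (r n a) (k n) (a * (1 - eta n))
                     | a in [set a : R | (n%:R^-1 < a < 2^-1)%R]])
          @ \oo --> 0%E].

End AMO.

(* Main.v *)
Require Import Defs.
From HB Require Import structures.
From mathcomp Require Import all_boot all_order all_algebra.
From mathcomp Require Import all_classical all_reals all_analysis.
From mathcomp Require Import measurable_realfun.
From mathcomp Require Import ring lra zify.

(** Let Q be the upper tail of the standard normal law.

    Impossibility rests on a confusion between contamination and scale.  For
    0 < p < 1 the wide law N(0, (1 - p)^-2) is the mixture of N(0, 1), with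
    weight 1 - p, and of a contaminating probability, with weight p
    ([normal_prob_decomposition]).  In the model where all entries follow the
    wide law every rejection is false, so a procedure controlling the FDR at
    level 1/4 rejects nothing with probability bounded below
    ([FDR_pure_null]).  The same data are those of a standard normal sample
    in which about n p entries were replaced with contaminated ones; there
    the oracle uses N(0, 1) and, at a level at least 1/8, rejects any entry
    beyond x in absolute value, where 2 Q x = 1 / (8 n).  Such entries exist
    with high probability: x ^ 2 is of order ln n, the wide tail at x is
    larger than the standard one by a factor of order exp (p x ^ 2 / 2), and
    with p = k / (8 n) the exponent is of order (k / n) ln n, which is
    unbounded.  So the procedure misses a discovery of the oracle
    ([lower_bound_finite]).  The labels of the replaced entries are random;
    [mixture_derandomization] fixes them while keeping at most k of them.

    Optimality has three ingredients.
    - Accuracy.  If the median, or the median absolute deviation, is off by a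
      relative error e, at least n / 2 - k null entries fall in a set of null
      probability at most 1/2 - c e, which is exponentially unlikely as soon
      as k <= n c e / 2 ([inaccurate_prob]).  So the relative error d may be
      taken of order k / n + n ^ (-1/4), and d ln n tends to 0.
    - Comparison of p-values.  Since the hazard rate of Q grows at most
      linearly ([mills_lb]), errors of size d multiply the p-values that are
      larger than n ^ (-2) by 1 + O(d ln n).  Hence the oracle at the level a
      (1 - kap), with kap of order d ln n, is contained in the plug-in
      procedure at the level a ([oracle_sub_plugin]), which controls the type
      II risk.
    - Stability.  The estimators are computed from the data that they
      standardize, so the usual proof of FDR control does not apply directly.
      But an entry rejected at a level below 1/2 is further from the median
      than the median absolute deviation; moving it outwards changes neither
      estimator, and the rejection set stays the same ([plugin_BH_stable]).
      Thus, with the other entries fixed and on each side of the center, the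
      number N of rejections is constant while i is rejected, and rejection
      implies that the true p-value of i is at most a N / (n (1 - kap)).
      Integrating 1 / N over coordinate i gives a / (n (1 - kap)), and
      summing over the nulls bounds the FDR by a / (1 - kap) plus the
      probability of an inaccurate estimation ([FDR_plugin_le]). *)

Set Implicit Arguments.
Unset Strict Implicit.
Unset Printing Implicit Defensive.

Import Order.TTheory GRing.Theory Num.Theory.
Import numFieldNormedType.Exports.

Local Open Scope classical_set_scope.
Local Open Scope ring_scope.

(** * The standard normal law *)

Section standard_normal.
Context {R : realType}.
Implicit Types (A : set R) (m s x y : R).
Local Notation mu := (@lebesgue_measure R).
Local Notation Q := (@normal_tail R).
Local Notation N := (@normal_prob R 0 1).

Let measurable_affine m s :
  measurable_fun setT
    ((fun z : R => m + s * z) : measurableTypeR R -> measurableTypeR R).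
Proof. by apply: measurable_funD => //; exact: measurable_funM. Qed.

Lemma measurable_EFin_normal_pdf m s (D : set R) :
  measurable_fun D (fun x : R => (normal_pdf m s x)%:E).
Proof.
by apply/measurable_EFinP; apply: measurable_funTS; exact: measurable_normal_pdf.
Qed.

(** The left-hand side is a measure in A which agrees with the Lebesgue
    measure on half-open intervals, and this characterizes the Lebesgue
    measure. *)
Lemma lebesgue_measure_affine m s A : 0 < s -> measurable A ->
  (s%:E * mu [set z : R | A (m + s * z)%R])%E = mu A.
Proof.
move=> s0 mA.
have s0' : 0 <= s by exact: ltW.
pose f : measurableTypeR R -> measurableTypeR R := fun z : R => m + s * z.
have mf : measurable_fun setT f by exact: measurable_affine.
pose nu0 := [the measure (measurableTypeR R) R of pushforward mu f].
pose nu1 := nu0 mf.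
pose nu := [the measure (measurableTypeR R) R of mscale (NngNum s0') nu1].
rewrite -[LHS]/(nu A); apply/esym/lebesgue_measure_unique => //= _ [[a b]] _ <-.
rewrite /nu /nu1 /nu0 /= /mscale /pushforward /=.
rewrite (_ : pushforward mu f _ = mu `](a - m) / s, (b - m) / s]%classic); last first.
  rewrite /pushforward; congr (mu _).
  apply/seteqP; split => z /=; rewrite !in_itv/= /f ltr_pdivrMr// ler_pdivlMr//;
    by rewrite ltrBlDl lerBrDl (mulrC s).
rewrite !lebesgue_measure_itv/= !lte_fin ltr_pM2r ?invr_gt0// ltrD2r.
case: ifPn => _; last by rewrite mule0.
by rewrite -!EFinD -EFinM; congr EFin; field; rewrite gt_eqF.
Qed.

Lemma normal_peakE s : 0 < s -> normal_peak s = s^-1 * normal_peak 1.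
Proof.
move=> s0; rewrite /normal_peak -invfM; congr (_^-1).
rewrite expr1n mul1r -mulrnAr sqrtrM ?sqr_ge0// sqrtr_sqr gtr0_norm//.
Qed.

(** Standardization: the change of variables x = m + s z turns the density of
    the normal law (m, s) into that of the standard one. *)
Lemma normal_prob_affine m s A : 0 < s -> measurable A ->
  normal_prob m s A = N [set z : R | A (m + s * z)].
Proof.
move=> s0 mA.
have s0' : 0 <= s by exact: ltW.
pose f : measurableTypeR R -> measurableTypeR R := fun z : R => m + s * z.
have mf : measurable_fun setT f by exact: measurable_affine.
have mfA : measurable (f @^-1` A).
  by rewrite -[X in measurable X]setTI; exact: mf.
pose nu0 := [the measure (measurableTypeR R) R of pushforward mu f].
pose nu1 := nu0 mf.
pose nu := [the measure (measurableTypeR R) R of mscale (NngNum s0') nu1].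
pose g : measurableTypeR R -> \bar R := fun x => (normal_pdf m s x)%:E.
have g0 : {in A, forall x, (0 <= g x)%E}.
  by move=> x _; rewrite lee_fin normal_pdf_ge0.
have mA' : measurable (A : set (measurableTypeR R)) by exact: mA.
have mg : measurable_fun (A : set (measurableTypeR R)) g by exact: measurable_EFin_normal_pdf.
have E := ge0_integral_pushforward mf lebesgue_measure mA' mg g0.
rewrite /normal_prob.
rewrite (@eq_measure_integral _ _ _ _ nu); last first.
  by move=> B mB _; exact/esym/lebesgue_measure_affine.
rewrite /nu/= ge0_integral_mscale//; last first.
  by move=> x _; rewrite lee_fin normal_pdf_ge0.
rewrite [X in (_ * X)%E]E -ge0_integralZl//=; last 2 first.
- apply: (measurable_comp mA' _ mg); last exact: measurable_funTS.
  by move=> _ [x Ax <-].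
- by move=> x _; rewrite lee_fin normal_pdf_ge0.
apply: eq_integral => x _; rewrite /g/= -EFinM; congr EFin.
rewrite !normal_pdfE ?gt_eqF//= normal_peakE// mulrA mulrA mulfV ?gt_eqF// mul1r.
rewrite /normal_fun /f addrAC subrr add0r subr0 exprMn expr1n.
congr (_ * expR _); field; by rewrite gt_eqF.
Qed.

Lemma normal_probN A : measurable A -> N [set z : R | A (- z)] = N A.
Proof.
move=> mA; rewrite /normal_prob.
pose f : measurableTypeR R -> measurableTypeR R := fun z : R => - z.
have mf : measurable_fun setT f by exact: oppr_measurable.
pose g : measurableTypeR R -> \bar R := fun x => (normal_pdf 0 1 x)%:E.
have g0 : {in A, forall x, (0 <= g x)%E}.
  by move=> x _; rewrite lee_fin normal_pdf_ge0.
have mA' : measurable (A : set (measurableTypeR R)) by exact: mA.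
have mg : measurable_fun (A : set (measurableTypeR R)) g by exact: measurable_EFin_normal_pdf.
have E := ge0_integral_pushforward mf lebesgue_measure mA' mg g0.
rewrite [RHS](@eq_measure_integral _ _ _ _ (pushforward mu f)); last first.
  by move=> B mB _; exact/esym/lebesgue_measureN.
rewrite [RHS]E; apply: eq_integral => x _ /=.
by rewrite /g /f !normal_pdfE//= /normal_fun !subr0 sqrrN.
Qed.

Lemma normal_prob_fin A : measurable A -> N A = (fine (N A))%:E.
Proof.
by move=> mA; rewrite fineK// fin_num_measure.
Qed.

Lemma normal_prob_oy x : N `]x, +oo[ = (Q x)%:E.
Proof. exact: normal_prob_fin. Qed.

Lemma normal_prob_cy x : N `[x, +oo[ = (Q x)%:E.
Proof.
rewrite -normal_prob_oy /normal_prob; apply/esym/integral_itv_obnd_cbnd.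
exact: measurable_EFin_normal_pdf.
Qed.

Lemma normal_prob_Nyo x : N `]-oo, x[ = (1 - Q x)%:E.
Proof.
rewrite -[X in N X](_ : ~` `[x, +oo[ = _); last by rewrite -setCitvr.
by rewrite [LHS](probability_setC N)// [X in (_ - X)%E]normal_prob_cy.
Qed.

Lemma normal_tailN x : Q (- x) = 1 - Q x.
Proof.
apply: EFin_inj; rewrite -normal_prob_Nyo -normal_prob_oy -normal_probN//.
by congr (N _); apply/seteqP; split => z /=; rewrite !in_itv/= ?andbT ltrN2.
Qed.

Lemma normal_tail0 : Q 0 = 2^-1.
Proof. have := normal_tailN 0; rewrite oppr0 => H; lra. Qed.

Lemma normal_prob_oc x y : x <= y -> N `]x, y] = (Q x - Q y)%:E.
Proof.
move=> xy; rewrite EFinB -!normal_prob_oy.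
have -> : `]x, y]%classic = `]x, +oo[%classic `\` `]y, +oo[%classic.
  apply/seteqP; split => z /=; rewrite !in_itv/= !andbT.
    by case/andP => -> zy; split => //; rewrite ltNge zy.
  by case=> -> /negP; rewrite -leNgt.
rewrite [LHS]measureD//=; last by rewrite normal_prob_oy ltry.
congr (_ - N _)%E; apply/setIidPr => z /=; rewrite !in_itv/= !andbT.
exact: le_lt_trans.
Qed.

Lemma normal_tail_ge0 x : 0 <= Q x.
Proof. by rewrite fine_ge0. Qed.

Lemma normal_tail_le x y : x <= y -> Q y <= Q x.
Proof.
by move=> xy; rewrite -subr_ge0 -lee_fin -normal_prob_oc.
Qed.

Definition normal_density x : R := normal_pdf 0 1 x.
Local Notation phi := normal_density.

Lemma normal_densityE x : phi x = phi 0 * expR (- (x ^+ 2) / 2).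
Proof.
rewrite /phi !normal_pdfE//= /normal_fun !subr0 expr0n/= oppr0 mul0r expR0 mulr1.
by rewrite expr1n.
Qed.

Lemma normal_density0_gt0 : 0 < phi 0.
Proof.
rewrite /phi !normal_pdfE//= /normal_fun !subr0 expr0n/= oppr0 mul0r expR0 mulr1.
exact: normal_peak_gt0.
Qed.

Lemma normal_density0_le1 : phi 0 <= 1.
Proof.
rewrite /phi !normal_pdfE//= /normal_fun !subr0 expr0n/= oppr0 mul0r expR0 mulr1.
rewrite /normal_peak expr1n mul1r invf_le1; last by rewrite sqrtr_gt0 pmulrn_rgt0// pi_gt0.
rewrite -[leLHS]sqrtr1 ler_wsqrtr// mulr2n.
have := pi_ge2 R; lra.
Qed.

Lemma normal_density_gt0 x : 0 < phi x.
Proof. by rewrite normal_densityE mulr_gt0 ?normal_density0_gt0 ?expR_gt0. Qed.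

Lemma normal_density_le x y : 0 <= x <= y -> phi y <= phi x.
Proof.
move=> /andP[x0 xy]; rewrite [phi y]normal_densityE [phi x]normal_densityE.
rewrite ler_pM2l ?normal_density0_gt0// ler_expR.
rewrite ler_wpM2r// lerN2 lerXn2r ?nnegrE//; exact: le_trans xy.
Qed.

Lemma normal_density_le0 x : phi x <= phi 0.
Proof.
rewrite [leLHS]normal_densityE ler_piMr ?(ltW normal_density0_gt0)//.
by rewrite -expR0 ler_expR mulNr oppr_le0 mulr_ge0// sqr_ge0.
Qed.

Lemma normal_prob_oc_ub x y c : x <= y ->
  (forall z, x < z <= y -> phi z <= c) -> Q x - Q y <= (y - x) * c.
Proof.
move=> xy H; rewrite -lee_fin -normal_prob_oc//.
have c0 : 0 <= c \/ x = y.
  move: xy; rewrite le_eqVlt => /orP[/eqP|xy]; [by right|left].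
  by apply: le_trans (H y _); rewrite ?xy ?lexx// ltW// normal_density_gt0.
case: c0 => [c0|->]; last by rewrite set_itvoc0 [X in (X <= _)%E]measure0 subrr mul0r.
apply: (@le_trans _ _ (\int[mu]_(x in `]x, y]) (cst c%:E x)))%E.
  apply: ge0_le_integral => //=.
  - by move=> z _; rewrite lee_fin normal_pdf_ge0.
  - exact: measurable_EFin_normal_pdf.
rewrite [X in (X <= _)%E]integral_cst// [X in (_ * X)%E]lebesgue_measure_itv/= lte_fin.
case: ifPn => _; first by rewrite -EFinD -EFinM lee_fin mulrC.
by rewrite mule0 lee_fin mulr_ge0// subr_ge0.
Qed.

Lemma normal_prob_oc_lb x y c : x <= y -> 0 <= c ->
  (forall z, x < z <= y -> c <= phi z) -> (y - x) * c <= Q x - Q y.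
Proof.
move=> xy c0 H; rewrite -lee_fin -normal_prob_oc//.
apply: (@le_trans _ _ (\int[mu]_(x in `]x, y]) (cst c%:E x)))%E; last first.
  apply: ge0_le_integral => //=.
  - exact: measurable_EFin_normal_pdf.
rewrite [X in (_ <= X)%E]integral_cst// [X in (_ * X)%E]lebesgue_measure_itv/= lte_fin.
move: xy; rewrite le_eqVlt => /orP[/eqP ->|->].
  by rewrite ltxx subrr mul0r mule0.
by rewrite -EFinD -EFinM lee_fin mulrC.
Qed.

Lemma normal_tail_lip x y : x <= y -> Q x - Q y <= y - x.
Proof.
move=> xy; rewrite -[leRHS]mulr1; apply: normal_prob_oc_ub => // z _.
exact: le_trans (normal_density_le0 z) normal_density0_le1.
Qed.

(** The density decreases on the positive half-line, so it lies between its
    end values on ]x, y]. *)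
Lemma normal_tail_sub_ub x y : 0 <= x <= y -> Q x - Q y <= (y - x) * phi x.
Proof.
move=> /andP[x0 xy]; apply: normal_prob_oc_ub => // z /andP[xz _].
by rewrite normal_density_le// x0 ltW.
Qed.

Lemma normal_tail_sub_lb x y : 0 <= x <= y -> (y - x) * phi y <= Q x - Q y.
Proof.
move=> /andP[x0 xy]; apply: normal_prob_oc_lb => // [|z /andP[xz zy]].
  exact/ltW/normal_density_gt0.
by rewrite normal_density_le// zy andbT (le_trans x0)// ltW.
Qed.

Lemma normal_tail_lt x y : x < y -> Q y < Q x.
Proof.
move=> xy; rewrite -subr_gt0.
set c := Num.min (phi x) (phi y).
have c0 : 0 < c by rewrite lt_min !normal_density_gt0.
suff : (y - x) * c <= Q x - Q y.
  by apply: lt_le_trans; rewrite mulr_gt0// subr_gt0.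
apply: normal_prob_oc_lb => // [||z /andP[xz zy]]; [exact: ltW..|].
have [z0|z0] := lerP 0 z.
  by rewrite ge_min; apply/orP; right; rewrite normal_density_le// z0.
rewrite ge_min; apply/orP; left.
rewrite normal_densityE [leRHS]normal_densityE ler_pM2l ?normal_density0_gt0//.
rewrite ler_expR ler_wpM2r// lerN2; nra.
Qed.

Lemma normal_tail_inj : injective Q.
Proof.
move=> x y; case: (ltgtP x y) => // /normal_tail_lt; lra.
Qed.

Lemma normal_tail_gt0 x : 0 < Q x.
Proof.
by rewrite (le_lt_trans (normal_tail_ge0 (x + 1)))// normal_tail_lt// ltrDl.
Qed.

Lemma normal_tail_ltE x y : (Q x < Q y) = (y < x).
Proof.
case: (ltgtP x y) => [/normal_tail_lt h|/normal_tail_lt|->].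
- by apply/negbTE; rewrite -leNgt ltW.
- by [].
- by rewrite ltxx.
Qed.

Lemma normal_tail_leE x y : (Q x <= Q y) = (y <= x).
Proof. by rewrite leNgt normal_tail_ltE -leNgt. Qed.

Lemma normal_tail_continuous : continuous Q.
Proof.
move=> x; apply/cvgrPdist_le => e e0; exists e => //= y /ltW h.
have [xy|/ltW yx] := leP x y.
  rewrite ger0_norm ?subr_ge0 ?normal_tail_le//.
  rewrite (le_trans (normal_tail_lip xy))//.
  by move: h; rewrite ?opprB// distrC => /(le_trans (ler_norm _)).
rewrite ler0_norm ?subr_le0 ?normal_tail_le// opprB.
by rewrite (le_trans (normal_tail_lip yx))// (le_trans _ h)// ler_norm.
Qed.

(** Comparison with the normal law of variance 2, whose total mass is 1: on
    the integration domain the ratio of the two densities is at most c below. *)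
Lemma normal_tail_expR x : 0 <= x -> Q x <= 2 * expR (- (x ^+ 2) / 4).
Proof.
move=> x0.
have H (z : R) : x < z -> - z ^+ 2 / 2 <= - x ^+ 2 / 4 + - z ^+ 2 / (2 *+ 2).
  move=> xz; have : x ^+ 2 <= z ^+ 2 by rewrite lerXn2r ?nnegrE// ltW// (le_lt_trans x0).
  by rewrite -(mulr_natr 2 2); lra.
rewrite -lee_fin -normal_prob_oy.
have s2 : 0 < Num.sqrt 2 :> R by rewrite sqrtr_gt0.
have s2n : Num.sqrt 2 != 0 :> R by rewrite gt_eqF.
pose c := Num.sqrt 2 * expR (- (x ^+ 2) / 4).
apply: (@le_trans _ _ (\int[mu]_(z in `]x, +oo[) (c%:E * (normal_pdf 0 (Num.sqrt 2) z)%:E))%E).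
  apply: ge0_le_integral => //=.
  - by move=> z _; rewrite lee_fin normal_pdf_ge0.
  - exact: measurable_EFin_normal_pdf.
  - apply/measurable_EFinP/measurable_funTS/measurable_funM => //.
    exact: measurable_normal_pdf.
  - move=> z; rewrite /= in_itv/= andbT => xz.
    rewrite -EFinM lee_fin !normal_pdfE//= normal_peakE// /normal_fun !subr0.
    rewrite sqr_sqrtr// (normal_peakE s2) expr1n /c invr1 mul1r mulrACA mulVKf//.
    rewrite -expRD ler_pM2l ?normal_peak_gt0// ler_expR.
    exact: H.
rewrite ge0_integralZl//=; last 3 first.
- exact: measurable_EFin_normal_pdf.
- by move=> z _; rewrite lee_fin normal_pdf_ge0.
- by rewrite lee_fin mulr_ge0// ?expR_ge0.
rewrite EFinM -[leRHS]mule1.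
have : (normal_prob 0 (Num.sqrt 2) `]x, +oo[%classic <= 1)%E by exact: probability_le1.
rewrite /normal_prob => h; apply: lee_pmul => //.
- by apply: integral_ge0 => z _; rewrite lee_fin normal_pdf_ge0.
rewrite -EFinM lee_fin ler_wpM2r ?expR_ge0//.
by rewrite -(@ler_pXn2r _ 2)// ?nnegrE// sqr_sqrtr// expr2; lra.
Qed.

(** By the intermediate value theorem between 0 and a point b where the tail
    is already below p. *)
Lemma normal_tail_surj p : 0 < p -> p <= 2^-1 -> exists2 x, 0 <= x & Q x = p.
Proof.
move=> p0 p2.
(* The tail bound and 1 + u <= exp u make any multiple of 1 / p that is large
   enough suitable. *)
pose b := 8 / p.
have b0 : 0 <= b by rewrite divr_ge0// ltW.
have Qb : Q b <= p.
  rewrite (le_trans (normal_tail_expR b0))//.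
  have b2 : 1 <= p * b by rewrite /b mulrCA mulfV ?gt_eqF// mulr1 ler1n.
  have : 1 + b ^+ 2 / 4 <= expR (b ^+ 2 / 4) by exact: expR_ge1Dx.
  rewrite mulNr expRN => h.
  have e0 : 0 < expR (b ^+ 2 / 4) by exact: expR_gt0.
  rewrite ler_pdivrMr//.
  have pb : p * b = 8 by rewrite /b mulrCA mulfV ?gt_eqF// mulr1.
  move: e0 h; set e := expR _ => e0 h.
  have b16 : 16 <= b by nra.
  have : b <= b ^+ 2 / 4 by nra.
  nra.
have [||x xb Qx] := @IVT R Q 0 b p b0.
- exact/continuous_subspaceT/normal_tail_continuous.
- by rewrite normal_tail0 ge_min Qb orbT le_max p2.
by exists x => //; move: xb; rewrite in_itv/= => /andP[].
Qed.

Lemma normal_tail_invE p : 0 < p -> p <= 2^-1 -> Q (normal_tail_inv p) = p.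
Proof.
move=> p0 p2; have [x _ Qx] := normal_tail_surj p0 p2.
by rewrite /normal_tail_inv; case: xgetP => [y -> //|/(_ x)].
Qed.

Lemma normal_tail_inv_gt0 p : 0 < p -> p < 2^-1 -> 0 < normal_tail_inv p :> R.
Proof.
move=> p0 p2; have := normal_tail_invE p0 (ltW p2).
by rewrite -normal_tail_ltE normal_tail0 => ->.
Qed.

(** Between x and x + 1 / (x + 1) the density drops by a bounded factor only,
    and this interval already has mass of order phi x / (x + 1).  With the
    upper bound on differences of tails this says that the relative decay
    rate of the tail at x is O(x + 1). *)
Lemma mills_lb x : 0 <= x -> phi x <= expR 2 * (x + 1) * Q x.
Proof.
move=> x0; pose h := (x + 1)^-1.
have x1 : 0 < x + 1 by lra.
have h0 : 0 < h by rewrite invr_gt0.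
have h1 : h <= 1 by rewrite invf_le1//; lra.
have hx : h * x <= 1 by rewrite mulrC ler_pdivrMr//; lra.
have : h * phi (x + h) <= Q x.
  have := @normal_tail_sub_lb x (x + h); rewrite x0 lerDl (ltW h0) => /(_ isT).
  rewrite (addrC x) addrK => /le_trans; apply.
  by rewrite lerBlDr lerDl normal_tail_ge0.
have : phi x <= expR 2 * phi (x + h).
  rewrite normal_densityE [phi (x + h)]normal_densityE mulrCA -expRD.
  rewrite ler_pM2l ?normal_density0_gt0// ler_expR; nra.
move=> h2 h3; rewrite (le_trans h2)// -mulrA ler_pM2l ?expR_gt0//.
by rewrite mulrC -ler_pdivrMr// mulrC.
Qed.

(** The form in which the tail is compared at two nearby points: moving x by
    less than order 1 / x changes the tail by a factor close to 1. *)
Lemma normal_tail_shift x y : 0 <= x <= y ->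
  Q x * (1 - expR 2 * (x + 1) * (y - x)) <= Q y.
Proof.
move=> xy; have /andP[x0 _] := xy.
have := normal_tail_sub_ub xy; have := mills_lb x0 => h1 h2.
have xy0 : 0 <= y - x by lra.
have : (y - x) * phi x <= (y - x) * (expR 2 * (x + 1) * Q x) by rewrite ler_wpM2l.
set E := expR 2; nra.
Qed.

(** Equal laws have equal tails, hence (x - m) / s = (x - m') / s' for all x
    because the standard tail is injective; evaluate at x = m and m + 1. *)
Lemma normal_prob_inj m s m' s' : 0 < s -> 0 < s' ->
  (forall A : set (measurableTypeR R), measurable A ->
    normal_prob m s A = normal_prob m' s' A) -> m = m' /\ s = s'.
Proof.
move=> s0 s0' H.
have E x : (x - m) / s = (x - m') / s'.
  apply: normal_tail_inj; apply: EFin_inj; rewrite -!normal_prob_oy.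
  have K (n t : R) : 0 < t -> N `](x - n) / t, +oo[%classic = normal_prob n t `]x, +oo[%classic.
    move=> t0; rewrite [RHS]normal_prob_affine//; congr (N _).
    apply/seteqP; split => z /=; rewrite !in_itv/= !andbT ltr_pdivrMr//;
    by rewrite ltrBlDl (mulrC t).
  rewrite (K m s s0) (K m' s' s0'); exact: H.
have /eqP := E m; rewrite subrr mul0r eq_sym mulf_eq0 invr_eq0 (gt_eqF s0') orbF.
rewrite subr_eq0 => /eqP mm'; split => //.
have := E (m + 1); rewrite -mm' (addrC m) addrK !mul1r => /invr_inj //.
Qed.

End standard_normal.

(** * Integration against product laws *)

Section product_integrals.
Context d (T : measurableType d) (R : realType).
Local Open Scope ereal_scope.

Lemma integral_probability_cst d' (T' : measurableType d')
    (Q : probability T' R) (c : \bar R) : \int[Q]_x (cst c x) = c.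
Proof. by rewrite integral_cst// [X in _ * X]probability_setT mule1. Qed.

Lemma measurable_tuple_cons2 n (x : T) :
  measurable_fun setT (fun z : n.-tuple T => tuple_cons (x, z)).
Proof.
apply: (measurableT_comp (@measurable_tuple_cons _ T n)).
exact: measurable_pair1.
Qed.

Lemma integral_product_lawS n (P : 'I_n.+1 -> probability T R)
    (f : n.+1.-tuple T -> \bar R) :
  measurable_fun setT f -> (forall y, 0 <= f y) ->
  \int[product_law P]_y f y =
  \int[P ord0]_x \int[product_law (fun i => P (lift ord0 i))]_z
     f (tuple_cons (x, z)).
Proof.
move=> mf f0; rewrite [LHS]ge0_integral_distribution//.
rewrite fubini_tonelli1//; last by move=> x; exact: f0.
exact: (measurableT_comp mf (@measurable_tuple_cons _ T n)).
Qed.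

Lemma integral_product_lawS_swap n (P : 'I_n.+1 -> probability T R)
    (f : n.+1.-tuple T -> \bar R) :
  measurable_fun setT f -> (forall y, 0 <= f y) ->
  \int[product_law P]_y f y =
  \int[product_law (fun i => P (lift ord0 i))]_z \int[P ord0]_x
     f (tuple_cons (x, z)).
Proof.
move=> mf f0; rewrite integral_product_lawS//.
apply: (fubini_tonelli (fun z => f (tuple_cons z))) => //.
exact: (measurableT_comp mf (@measurable_tuple_cons _ T n)).
Qed.

Definition set_coord n (i : 'I_n) (x : T) (y : n.-tuple T) : n.-tuple T :=
  [tuple (if j == i then x else tnth y j) | j < n].

(** Conditioning on the other coordinates: a bound on the inner integral over
    one coordinate, uniform in the others, bounds the whole integral. *)
Lemma integral_product_law_le_coord n (P : 'I_n -> probability T R)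
    (f : n.-tuple T -> \bar R) (i : 'I_n) (c : R) :
  measurable_fun setT f -> (forall y, 0 <= f y) ->
  (forall y, \int[P i]_x f (set_coord i x y) <= c%:E) ->
  \int[product_law P]_y f y <= c%:E.
Proof.
elim: n P f i => [|n IH] P f i mf f0 fc; first by case: i fc.
have mcons : measurable_fun setT (fun z : T * n.-tuple T => f (tuple_cons z)).
  exact: (measurableT_comp mf (@measurable_tuple_cons _ T n)).
have [x0 _] : [set: T] !=set0.
  apply/set0P/negP => /eqP T0; have := @probability_setT _ _ _ (P ord0).
  rewrite T0 measure0 => /eqP; rewrite eqe.
  by move=> /eqP h; have := @oner_neq0 R; rewrite -h eqxx.
have [j ij|i0] := unliftP ord0 i; last first.
  rewrite integral_product_lawS_swap// -(integral_probability_cst (product_law (fun i => P (lift ord0 i))) c%:E).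
  apply: ge0_le_integral => //=.
  - by move=> z _; exact: integral_ge0.
  - exact: (measurable_fun_fubini_tonelli_G (fun z => f (tuple_cons z))).
  - move=> z _; have := fc (tuple_cons (x0, z)); rewrite i0.
    congr (_ <= _); apply: eq_integral => x _; congr f.
    apply: eq_from_tnth => k; rewrite tnth_mktuple.
    have [l ->|->] := unliftP ord0 k.
      by rewrite eq_sym (negbTE (neq_lift _ _)) /tuple_cons !tnthS.
    by rewrite eqxx /tuple_cons tnth0.
rewrite integral_product_lawS// -(integral_probability_cst (P ord0) c%:E).
apply: ge0_le_integral => //=.
- by move=> z _; exact: integral_ge0.
- exact: (measurable_fun_fubini_tonelli_F (fun z => f (tuple_cons z))).
- move=> x _; apply: (IH _ _ j) => //.
    exact: (measurableT_comp mf (@measurable_tuple_cons2 n x)).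
  move=> z; have := fc (tuple_cons (x, z)); rewrite ij.
  congr (_ <= _); apply: eq_integral => x' _; congr f.
  apply: eq_from_tnth => k; rewrite tnth_mktuple.
  have [l ->|->] := unliftP ord0 k; last first.
    by rewrite (negbTE (neq_lift _ _)) /tuple_cons !tnth0.
  by rewrite /tuple_cons !tnthS tnth_mktuple (inj_eq lift_inj).
Qed.

Lemma measurable_prod_tnth n (g : 'I_n -> T -> R) :
  (forall i, measurable_fun setT (g i)) ->
  measurable_fun setT (fun y : n.-tuple T => \prod_(i < n) g i (tnth y i))%R.
Proof.
move=> mg; apply: measurable_prod => i _.
exact: (measurableT_comp (mg i) (measurable_tnth i)).
Qed.

(** Independence, for nonnegative factors. *)
Lemma integral_product_law_prod n (P : 'I_n -> probability T R)
    (g : 'I_n -> T -> R) (c : 'I_n -> R) :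
  (forall i, measurable_fun setT (g i)) -> (forall i x, 0 <= g i x)%R ->
  (forall i, \int[P i]_x (g i x)%:E <= (c i)%:E) ->
  \int[product_law P]_y (\prod_(i < n) g i (tnth y i))%R%:E
    <= (\prod_(i < n) c i)%R%:E.
Proof.
elim: n P g c => [|n IH] P g c mg g0 gc.
  rewrite big_ord0 (eq_integral (cst 1)); last by move=> y _; rewrite big_ord0.
  by rewrite (integral_probability_cst _ 1).
have c0 i : (0 <= c i)%R.
  by rewrite -lee_fin (le_trans _ (gc i))// integral_ge0// => x _; rewrite lee_fin.
have C0 : (0 <= \prod_(i < n) c (lift ord0 i))%R by exact: prodr_ge0.
rewrite integral_product_lawS; last 2 first.
- by apply/measurable_EFinP; exact: measurable_prod_tnth.
- by move=> y; rewrite lee_fin prodr_ge0.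
have mp : measurable_fun setT
    (fun z : n.-tuple T => (\prod_(i < n) g (lift ord0 i) (tnth z i))%R%:E).
  apply/measurable_EFinP.
  exact: (measurable_prod_tnth (fun i => mg (lift ord0 i))).
rewrite big_ord_recl mulrC EFinM.
apply: (@le_trans _ _ (\int[P ord0]_x
    ((\prod_(i < n) c (lift ord0 i))%R%:E * (g ord0 x)%:E))).
  rewrite (eq_integral (fun x => (g ord0 x)%:E *
      \int[product_law (fun i => P (lift ord0 i))]_z
         (\prod_(i < n) g (lift ord0 i) (tnth z i))%R%:E)); last first.
    move=> x _; rewrite -ge0_integralZl//; last 2 first.
    - by move=> z _; rewrite lee_fin prodr_ge0.
    - by rewrite lee_fin.
    apply: eq_integral => z _; rewrite -EFinM; congr EFin.
    rewrite big_ord_recl /tuple_cons tnth0; congr (_ * _)%R.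
    by apply: eq_bigr => i _; rewrite tnthS.
  apply: ge0_le_integral => //.
  - move=> x _; rewrite mule_ge0 ?lee_fin// integral_ge0// => z _.
    by rewrite lee_fin prodr_ge0.
  - apply: emeasurable_funM => //; exact/measurable_EFinP.
  - apply: emeasurable_funM => //; exact/measurable_EFinP.
  - move=> x _; rewrite muleC lee_wpmul2r ?lee_fin//.
    by apply: (IH _ (fun i => g (lift ord0 i)) (fun i => c (lift ord0 i))).
rewrite ge0_integralZl//; last 2 first.
- exact/measurable_EFinP.
- by move=> x _; rewrite lee_fin.
by apply: lee_wpmul2l; [rewrite lee_fin|exact: gc].
Qed.

(** A sample of the mixture M = (1 - p) A + p B can be drawn by first tossing
    labels.  The average over labels of (probability) - c (number of labels)
    is its value for the mixture and the mean number p n of labels, so some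
    deterministic label vector does at least as well.  Fixing the labels one
    coordinate at a time avoids introducing the law of the labels.  The cost
    c controls the number of labels and the probability simultaneously. *)
Lemma mixture_derandomization n (A B M : probability T R) (p c : R)
    (f : n.-tuple T -> \bar R) :
  (0 <= p <= 1)%R ->
  (forall g : T -> \bar R, measurable_fun setT g -> (forall x, 0 <= g x) ->
    \int[M]_x g x = (1 - p)%:E * \int[A]_x g x + p%:E * \int[B]_x g x) ->
  measurable_fun setT f -> (forall y, 0 <= f y) -> (forall y, f y <= 1) ->
  exists L : 'I_n -> bool,
    \int[product_law (fun _ : 'I_n => M)]_y f y + (c * \sum_i (L i)%:R)%:E <=
    \int[product_law (fun i => if L i then B else A)]_y f y
      + (c * (p * n%:R))%:E.
Proof.
move=> /andP[p0 p1] hM; elim: n f => [|n IH] f mf f0 f1.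
  exists (fun _ => false); rewrite big_ord0 !mulr0 leeD2r//.
have mcons : measurable_fun setT (fun z : T * n.-tuple T => f (tuple_cons z)).
  exact: (measurableT_comp mf (@measurable_tuple_cons _ T n)).
have int01 d' (T' : measurableType d') (Q : probability T' R) (g : T' -> \bar R) :
    measurable_fun setT g -> (forall x, 0 <= g x <= 1) -> 0 <= \int[Q]_x g x <= 1.
  move=> mg g01; apply/andP; split.
    by apply: integral_ge0 => x _; case/andP: (g01 x).
  rewrite -[leRHS](integral_probability_cst Q).
  apply: ge0_le_integral => //.
  - by move=> x _; case/andP: (g01 x).
  - by move=> x _; case/andP: (g01 x).
pose F x := \int[product_law (fun _ : 'I_n => M)]_z f (tuple_cons (x, z)).
have mF : measurable_fun setT F by exact: (measurable_fun_fubini_tonelli_F (fun z => f (tuple_cons z))).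
have F01 x : 0 <= F x <= 1.
  apply: int01 => [|z]; last by rewrite f0 f1.
  exact: (measurableT_comp mf (@measurable_tuple_cons2 n x)).
have eqF : \int[product_law (fun _ : 'I_n.+1 => M)]_y f y =
    (1 - p)%:E * \int[A]_x F x + p%:E * \int[B]_x F x.
  by rewrite integral_product_lawS// hM// => x; case/andP: (F01 x).
(* The mixture is the average of the two choices with weights 1 - p and p,
   and so is the cost c p: one choice is at least as good as the average. *)
have [e he] : exists e : bool,
    \int[product_law (fun _ : 'I_n.+1 => M)]_y f y + (c * e%:R)%:E <=
    \int[if e then B else A]_x F x + (c * p)%:E.
  have /andP[a0 a1] := int01 _ _ A F mF F01.
  have /andP[b0 b1] := int01 _ _ B F mF F01.
  rewrite eqF; move: a0 a1 b0 b1.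
  set a := \int[A]_x F x; set b := \int[B]_x F x => a0 a1 b0 b1.
  have fa : a \is a fin_num by rewrite ge0_fin_numE// (le_lt_trans a1)// ltry.
  have fb : b \is a fin_num by rewrite ge0_fin_numE// (le_lt_trans b1)// ltry.
  have Ea := esym (fineK fa); have Eb := esym (fineK fb).
  rewrite Ea Eb; set ra := fine a in Ea *; set rb := fine b in Eb *.
  have [h|h] := lerP ra (rb - c).
    exists true; rewrite -/b Eb -!EFinM -!EFinD lee_fin mulr1n.
    have : (0 <= (1 - p) * (rb - c - ra))%R by rewrite mulr_ge0 ?subr_ge0.
    lra.
  exists false; rewrite -/a Ea -!EFinM -!EFinD lee_fin mulr0n mulr0 addr0.
  have : (0 <= p * (ra - (rb - c)))%R by rewrite mulr_ge0 ?subr_ge0// ltW.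
  lra.
pose f' z := \int[if e then B else A]_x f (tuple_cons (x, z)).
have mf' : measurable_fun setT f' by exact: (measurable_fun_fubini_tonelli_G (fun z => f (tuple_cons z))).
have f'01 z : 0 <= f' z <= 1.
  apply: int01 => [|x]; last by rewrite f0 f1.
  apply: (measurableT_comp mf); apply: (measurableT_comp (@measurable_tuple_cons _ T n)).
  exact: measurable_pair2.
have [||L hL] := IH f' mf'.
- by move=> z; case/andP: (f'01 z).
- by move=> z; case/andP: (f'01 z).
pose L' i := if unlift ord0 i is Some j then L j else e.
have L'0 : L' ord0 = e by rewrite /L' unlift_none.
have L'S j : L' (lift ord0 j) = L j by rewrite /L' liftK.
exists L'.
rewrite [X in _ <= X + _]integral_product_lawS_swap// L'0.
rewrite (_ : (fun i => if L' (lift ord0 i) then B else A) =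
  (fun i => if L i then B else A)); last by apply/funext => i; rewrite L'S.
rewrite big_ord_recl L'0 (eq_bigr (fun i => (L i)%:R)); last first.
  by move=> i _; rewrite L'S.
have swp : \int[if e then B else A]_x F x =
    \int[product_law (fun _ : 'I_n => M)]_z f' z.
  by apply: (fubini_tonelli (fun z => f (tuple_cons z))).
rewrite swp in he.
rewrite mulrDr EFinD addeA (le_trans (leeD2r _ he))// addeAC.
rewrite (le_trans (leeD2r _ hL))// -addeA -EFinD leeD2l// lee_fin.
by rewrite -addn1 natrD !mulrDr mulr1.
Qed.

Lemma measurable_fun_if_in (A : set T) (a b : R) : measurable A ->
  measurable_fun setT (fun x => if `[< A x >] then a else b).
Proof.
move=> mA.
rewrite (_ : (fun x => _) = (fun x => b + (a - b) * \1_A x)%R); last first.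
  apply/funext => x; rewrite indicE; case: asboolP => Ax.
    by rewrite mem_set// mulr1 addrC subrK.
  by rewrite memNset// mulr0 addr0.
by apply: measurable_funD => //; apply: measurable_funM => //; exact: measurable_indic.
Qed.

Lemma integral_if_in (Q : probability T R) (A : set T) (p a : R) :
  measurable A -> Q A <= p%:E -> (1 <= a)%R ->
  \int[Q]_x (if `[< A x >] then a else 1%R)%:E <= (expR (p * (a - 1)))%:E.
Proof.
move=> mA QA a1.
rewrite (eq_integral (fun x => 1 + (a - 1)%:E * (\1_A x)%:E)); last first.
  move=> x _; rewrite indicE; case: asboolP => Ax.
    by rewrite mem_set// mule1 -EFinD addrC subrK.
  by rewrite memNset// mule0 adde0.
have a10 : (0 <= a - 1)%R by rewrite subr_ge0.
have mI : measurable_fun setT (fun x => (\1_A x : R)%:E).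
  by apply/measurable_EFinP; exact: measurable_indic.
rewrite ge0_integralD//; last 2 first.
- by move=> x _; rewrite mule_ge0// lee_fin.
- exact: emeasurable_funM.
rewrite ge0_integralZl ?lee_fin//.
rewrite integral_indic// setIT.
rewrite [X in X + _](integral_probability_cst Q 1).
apply: (@le_trans _ _ (1 + (a - 1)%:E * p%:E)).
  by rewrite leeD2l// lee_wpmul2l.
by rewrite -EFinM -EFinD lee_fin mulrC expR_ge1Dx.
Qed.

(** Exponential Markov inequality for a count of independent events over H:
    the factor of each coordinate has mean at most exp (p (exp l - 1)). *)
Lemma chernoff_count n (P : 'I_n -> probability T R) (A : 'I_n -> set T)
    (H : {set 'I_n}) (E : set (n.-tuple T)) (p b l : R) :
  (forall i, measurable (A i)) -> (forall i, i \in H -> P i (A i) <= p%:E) ->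
  (0 <= p)%R -> (0 <= l)%R -> measurable E ->
  (forall y, E y -> b <= \sum_(i in H) (`[< A i (tnth y i) >])%:R)%R ->
  product_law P E <= (expR (- l * b + n%:R * p * (expR l - 1)))%:E.
Proof.
move=> mA PA p0 l0 mE hE.
have el1 : (1 <= expR l)%R by rewrite -expR0 ler_expR.
pose g (i : 'I_n) (x : T) : R :=
  if i \in H then (if `[< A i x >] then expR l else 1%R) else 1%R.
have mg i : measurable_fun setT (g i).
  by rewrite /g; case: (i \in H) => //; exact: measurable_fun_if_in.
have g0 i x : (0 <= g i x)%R.
  by rewrite /g; do 2!case: ifP => // _; exact: expR_ge0.
have gE y : (\prod_(i < n) g i (tnth y i) =
    expR (l * \sum_(i in H) (`[< A i (tnth y i) >])%:R))%R.
  rewrite mulr_sumr expR_sum [RHS]big_mkcond/=; apply: eq_bigr => i _.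
  by rewrite /g; case: ifP => // _; case: asboolP => _; rewrite ?mulr1 ?mulr0 ?expR0.
rewrite -(setIT E) -integral_indic//.
have mG : measurable_fun setT
    (fun y : n.-tuple T => (\prod_(i < n) g i (tnth y i))%R%:E).
  by apply/measurable_EFinP; exact: measurable_prod_tnth.
apply: (@le_trans _ _ (\int[product_law P]_y
    ((expR (- l * b))%:E * (\prod_(i < n) g i (tnth y i))%R%:E))).
  apply: ge0_le_integral => //=.
  - by apply/measurable_EFinP; exact: measurable_indic.
  - exact: emeasurable_funM.
  - move=> y _; rewrite indicE; have [/set_mem Ey|nEy] := boolP (y \in E).
      rewrite -EFinM gE -expRD lee_fin -[leLHS]expR0 ler_expR mulNr addrC subr_ge0.
      by rewrite ler_wpM2l// hE.
    by rewrite -EFinM lee_fin mulr_ge0 ?expR_ge0 ?prodr_ge0.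
rewrite ge0_integralZl ?lee_fin ?expR_ge0//; last first.
  by move=> y _; rewrite lee_fin prodr_ge0.
rewrite expRD EFinM lee_wpmul2l ?lee_fin ?expR_ge0//.
have := @integral_product_law_prod n P g (fun _ => expR (p * (expR l - 1))) mg g0.
move=> /(_ _)/le_trans; apply.
  move=> i; rewrite /g; have [iH|iH] := boolP (i \in H).
    by apply: integral_if_in => //; exact: PA.
  rewrite (integral_probability_cst (P i) 1).
  apply: (@le_trans _ _ (expR 0)%:E); first by rewrite expR0.
  by rewrite lee_fin ler_expR mulr_ge0// subr_ge0.
by rewrite prodr_const card_ord lee_fin -expRM_natl mulrA.
Qed.

(** Sets of probability below 1/2 by a margin z rarely contain almost half of
    the coordinates.  The slack kk allows for discarding some coordinates; it
    may use up half of the margin. *)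
Lemma chernoff_half n (P : 'I_n -> probability T R) (A : 'I_n -> set T)
    (H : {set 'I_n}) (E : set (n.-tuple T)) (z kk : R) :
  (forall i, measurable (A i)) ->
  (forall i, i \in H -> P i (A i) <= (2^-1 - z)%:E) ->
  (0 <= z <= 2^-1)%R -> (kk <= n%:R * z / 2)%R -> measurable E ->
  (forall y, E y -> n%:R / 2 - kk <= \sum_(i in H) (`[< A i (tnth y i) >])%:R)%R ->
  product_law P E <= (expR (- (n%:R * z ^+ 2 / 16)))%:E.
Proof.
move=> mA PA /andP[z0 z2] kz mE hE.
(* The exponent l is z / 4, the optimal order: the gain l n z / 2 must beat
   the second order term, of order n l ^ 2. *)
have l0 : (0 <= z / 4)%R by lra.
have p0 : (0 <= 2^-1 - z)%R by lra.
apply: le_trans (chernoff_count mA PA p0 l0 mE hE) _.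
rewrite lee_fin ler_expR.
have e1 : (expR (z / 4) <= 1 + z / 4 + 2 * (z / 4) ^+ 2)%R.
  have := expR_ge1Dx (- (z / 4)); rewrite expRN => h.
  have e0 := expR_gt0 (z / 4).
  have : (expR (z / 4) * (1 - z / 4) <= 1)%R.
    by rewrite mulrC -ler_pdivlMr// mul1r.
  by move: e0; set e := expR _; nra.
have n0 : (0 <= n%:R :> R)%R by [].
have h1 : (n%:R * (2^-1 - z) * (expR (z / 4) - 1) <=
   n%:R * (2^-1 - z) * (z / 4 + 2 * (z / 4) ^+ 2))%R.
  by rewrite ler_wpM2l ?mulr_ge0//; lra.
have h2 : (z / 4 * kk <= z / 4 * (n%:R * z / 2))%R by rewrite ler_wpM2l.
have h3 : (0 <= n%:R * (z * z ^+ 2))%R by rewrite !mulr_ge0 ?sqr_ge0.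
by apply: le_trans (_ : _ <= - (z / 4) * (n%:R / 2 - kk) + n%:R * (2^-1 - z) * (z / 4 + 2 * (z / 4) ^+ 2))%R _; [lra|nra].
Qed.

End product_integrals.

(** * Medians *)

Section median_theory.
Context {R : realType}.
Implicit Types (v : seq R) (c t : R).

Let uphalf_pred_lt v : (0 < size v)%N -> ((uphalf (size v)).-1 < size v)%N.
Proof. by move=> v0; rewrite uphalf_half; lia. Qed.

Lemma median_le v c : (0 < size v)%N ->
  (median v <= c) = (uphalf (size v) <= count (<= c) v)%N.
Proof.
move=> v0; rewrite /median /order_stat.
have ps : perm_eq (sort <=%R v) v by rewrite perm_sort.
have u0 : (0 < uphalf (size v))%N by rewrite uphalf_half; lia.
rewrite -(permP ps); have so : sorted <=%R (sort <=%R v) by exact: sort_le_sorted.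
apply/idP/idP => [h|h]; last by apply: nth_count_le => //; rewrite prednK.
rewrite leqNgt; apply/negP => h'.
have ss : size (sort <=%R v) = size v by rewrite size_sort.
set s := sort _ v in so h h' ps ss *; set m := uphalf _ in u0 h h' *.
have : all (<= c) (take m s).
  apply/(all_nthP 0) => i; rewrite size_take_min ltn_min => /andP[im iv].
  rewrite nth_take//; apply: le_trans h.
  apply: le_sorted_leq_nth => //; rewrite ?inE ?ss ?uphalf_pred_lt//.
  by rewrite -ltnS prednK.
rewrite all_count => /eqP E.
move: h'; rewrite ltnNge => /negP; apply.
rewrite -[in X in (_ <= count _ X)%N](cat_take_drop m s) count_cat E size_takel; last first.
  by rewrite ss /m uphalf_half; lia.
exact: leq_addr.
Qed.

Lemma le_median v c : (0 < size v)%N ->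
  (c <= median v) = (count (< c) v < uphalf (size v))%N.
Proof.
move=> v0; rewrite /median /order_stat.
have ps : perm_eq (sort <=%R v) v by rewrite perm_sort.
have u0 : (0 < uphalf (size v))%N by rewrite uphalf_half; lia.
rewrite -(permP ps); have so : sorted <=%R (sort <=%R v) by exact: sort_le_sorted.
have ss : size (sort <=%R v) = size v by rewrite size_sort.
apply/idP/idP => [h|h]; last first.
  by apply: nth_count_ge => //; rewrite ss uphalf_pred_lt// andbT -ltnS prednK.
set s := sort _ v in so h ps ss *; set m := uphalf _ in u0 h *.
rewrite -[in X in count _ X](cat_take_drop m.-1 s) count_cat.
have -> : count (< c) (drop m.-1 s) = 0%N.
  apply/eqP; rewrite -leqn0 leqNgt -has_count; apply/negP => /(has_nthP 0)[i].
  rewrite size_drop => im; rewrite nth_drop => /lt_geF.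
  suff -> : c <= s`_(m.-1 + i) by [].
  apply: (le_trans h); apply: le_sorted_leq_nth => //; rewrite ?inE ?ss ?leq_addr//.
  - exact: uphalf_pred_lt.
  - by move: im; rewrite ss; have := uphalf_pred_lt v0; rewrite -/m; lia.
rewrite addn0 (leq_ltn_trans (count_size _ _))// size_takel; first by rewrite prednK.
by rewrite ss ltnW// uphalf_pred_lt.
Qed.

Lemma median_unique v t : (0 < size v)%N ->
  (count (< t) v < uphalf (size v) <= count (<= t) v)%N -> median v = t.
Proof.
move=> v0 /andP[h1 h2]; apply/le_anti.
by rewrite median_le// h2 le_median// h1.
Qed.

Lemma median_eq v v' : (0 < size v)%N -> size v = size v' ->
  count (< median v) v = count (< median v) v' ->
  count (<= median v) v = count (<= median v) v' -> median v' = median v.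
Proof.
move=> v0 vv' E1 E2; apply: median_unique; first by rewrite -vv'.
by rewrite -E1 -E2 -vv' -le_median// lexx -median_le// lexx.
Qed.

Lemma count_tuple n (T : Type) (p : pred T) (Y : n.-tuple T) :
  count p Y = (\sum_(j < n) p (tnth Y j))%N.
Proof. by rewrite -sumn_count sumnE big_map big_tuple. Qed.

End median_theory.

(** * The step-up procedure *)

Section BH_theory.
Context {R : realType} (n : nat).
Implicit Types (Y : observation R n) (a u s : R) (i j : 'I_n).

Definition pcount Y u s (t : R) : nat :=
  #|finset (fun j : 'I_n => pvalue Y u s j <= t)|.

Lemma pcountE Y u s t : \sum_(i < n) (pvalue Y u s i <= t)%R%:R = (pcount Y u s t)%:R :> R.
Proof.
rewrite /pcount -sum1_card natr_sum [RHS]big_mkcond/=; apply: eq_bigr => i _.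
by rewrite inE; case: ifP.
Qed.

Lemma le_pcount Y u s t t' : t <= t' -> (pcount Y u s t <= pcount Y u s t')%N.
Proof.
move=> tt'; apply: subset_leq_card; apply/fintype.subsetP => i; rewrite !inE.
by move=> /le_trans; exact.
Qed.

Lemma pcount_le Y u s t : (pcount Y u s t <= n)%N.
Proof. by rewrite (leq_trans (max_card _))// card_ord. Qed.

(** The usual step-up description: i is rejected as soon as, for some m, its
    p-value is below the critical level a m / n and at least m p-values are.
    Unlike the supremum over real levels it involves finitely many
    comparisons of p-values. *)
Lemma in_BHP a Y u s i : 0 < a <= 1 -> reflect
  (exists2 m : nat, (0 < m <= n)%N & (m <= pcount Y u s (a * m%:R / n%:R))%N /\
     pvalue Y u s i <= a * m%:R / n%:R)
  (i \in BH a Y u s).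
Proof.
move=> /andP[a0 a1]; have n0 : (0 < n)%N := leq_ltn_trans (leq0n _) (ltn_ord i).
have n0' : 0 < n%:R :> R by rewrite ltr0n.
have [[/andP[T0 T1] HT] ubT] := BH_threshold_max Y u s a0.
rewrite inE; apply: (iffP idP) => [iT|[m /andP[m0 mn] [mc pi]]].
  exists (pcount Y u s (BH_threshold a Y u s)).
    rewrite pcount_le andbT; apply/card_gt0P; exists i; by rewrite inE.
  have TN : BH_threshold a Y u s <=
      a * (pcount Y u s (BH_threshold a Y u s))%:R / n%:R.
    rewrite ler_pdivlMr// -ler_pdivrMl// -pcountE (le_trans _ HT)//.
    by rewrite mulrC (mulrC n%:R).
  by split; [exact: le_pcount|exact: le_trans TN].
apply: (le_trans pi); apply: ubT; split.
  rewrite divr_ge0 ?mulr_ge0 ?(ltW a0)//= ler_pdivrMr// mul1r.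
  by rewrite -[leRHS]mul1r ler_pM// ?ler_nat// ltW.
rewrite pcountE; apply: (@le_trans _ _ m%:R); last by rewrite ler_nat.
by rewrite le_eqVlt; apply/orP; left; apply/eqP; field; rewrite !gt_eqF.
Qed.

(** All the hypotheses counted at the critical level of i are rejected as
    well. *)
Lemma BH_self_consistent a Y u s i : 0 < a <= 1 -> i \in BH a Y u s ->
  pvalue Y u s i <= a * #|BH a Y u s|%:R / n%:R.
Proof.
move=> a01 /(in_BHP _ _ _ _ a01)[m m0 [mc pi]].
apply: (le_trans pi); rewrite -!mulrA ler_wpM2l//; first by case/andP: a01 => /ltW.
rewrite ler_wpM2r// ?invr_ge0// ler_nat (leq_trans mc)//.
apply: subset_leq_card; apply/fintype.subsetP => j; rewrite inE => pj.
by apply/in_BHP => //; exists m.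
Qed.

(** Decreasing the p-value of a rejected hypothesis can only add rejections;
    it adds none, because that hypothesis was already below the critical
    level of the r rejections, so that the counts at higher levels do not
    change. *)
Lemma BH_stable a Y Y' u s i : 0 < a <= 1 ->
  (forall j, j != i -> pvalue Y' u s j = pvalue Y u s j) ->
  pvalue Y' u s i <= pvalue Y u s i ->
  i \in BH a Y u s -> BH a Y' u s = BH a Y u s.
Proof.
move=> a01 E pi iBH; have [a0 a1] := andP a01.
have n0 : (0 < n)%N := leq_ltn_trans (leq0n _) (ltn_ord i).
have n0' : 0 < n%:R :> R by rewrite ltr0n.
have ple j : pvalue Y' u s j <= pvalue Y u s j.
  by have [->//|/E->] := eqVneq j i.
have sub : BH a Y u s \subset BH a Y' u s.
  apply/fintype.subsetP => j /(in_BHP _ _ _ _ a01)[m m0 [mc pj]].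
  apply/in_BHP => //; exists m => //; split; last exact: le_trans pj.
  rewrite (leq_trans mc)//; apply: subset_leq_card; apply/fintype.subsetP => k.
  by rewrite !inE; exact: le_trans.
apply/eqP; rewrite finset.eqEsubset; apply/andP; split; last exact: sub.
apply/fintype.subsetP => j.
move=> /(in_BHP _ _ _ _ a01)[m m0 [mc pj]].
have [->//|ji] := eqVneq j i.
have := BH_self_consistent a01 iBH.
set r := #|BH a Y u s| => pir.
(* For m <= r the p-value of j is below the level a r / n, at which all r
   rejections are counted; for m > r the p-value of i is below a m / n
   already in Y, so the counts at that level agree. *)
have [mr|rm] := leqP m r.
  have pjr : pvalue Y u s j <= a * r%:R / n%:R.
    rewrite -E// (le_trans pj)// -!mulrA ler_wpM2l ?(ltW a0)// ler_wpM2r ?invr_ge0//.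
    by rewrite ler_nat.
  apply/in_BHP => //; exists r.
    rewrite (leq_trans _ mr)/=; last by case/andP: m0.
    by rewrite (leq_trans (max_card _))// card_ord.
  split => //; apply: subset_leq_card; apply/fintype.subsetP => k kBH.
  by rewrite inE BH_self_consistent.
apply/in_BHP => //; exists m => //; split; last by rewrite -E.
rewrite (leq_trans mc)//; apply: subset_leq_card; apply/fintype.subsetP => k.
rewrite !inE; have [-> _|/E->//] := eqVneq k i.
rewrite (le_trans pir)// -!mulrA ler_wpM2l ?(ltW a0)// ler_wpM2r ?invr_ge0//.
by rewrite ler_nat ltnW.
Qed.

End BH_theory.

(** * Stability of the plug-in procedure *)

Section plugin_stability.
Context {R : realType} (n : nat).
Implicit Types (Y : observation R n) (a u s : R) (i j : 'I_n).

Definition median_abs_dev Y : R := median [seq `|y - theta_est Y| | y : R <- Y].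

Lemma normal_quartile_tail : normal_tail (normal_tail_inv (1 / 4)) = 4^-1 :> R.
Proof. by rewrite normal_tail_invE ?mul1r//; lra. Qed.

Lemma normal_quartile_gt0 : 0 < normal_tail_inv (1 / 4) :> R.
Proof. by apply: normal_tail_inv_gt0; lra. Qed.

Lemma sigma_estE Y : sigma_est Y = median_abs_dev Y / normal_tail_inv (1 / 4).
Proof. by []. Qed.

Lemma median_abs_dev_ge0 Y : (0 < n)%N -> 0 <= median_abs_dev Y.
Proof.
move=> n0; rewrite /median_abs_dev le_median ?size_map ?size_tuple//.
rewrite (_ : count _ _ = 0%N) ?uphalf_half; first by lia.
apply/eqP; rewrite -leqn0 leqNgt -has_count; apply/negP => /hasP[x /mapP[y _ ->]].
by move=> /lt_geF; rewrite normr_ge0.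
Qed.

(** An entry that stays on one side of the median does not affect it. *)
Lemma median_move (v v' : n.-tuple R) i :
  (forall j, j != i -> tnth v' j = tnth v j) ->
  (median v < tnth v i /\ median v < tnth v' i) \/
  (tnth v i < median v /\ tnth v' i < median v) -> median v' = median v.
Proof.
move=> E side; have n0 : (0 < n)%N := leq_ltn_trans (leq0n _) (ltn_ord i).
apply: median_eq; rewrite ?size_tuple// !count_tuple; apply: eq_bigr => j _;
  (have [->|/E->//] := eqVneq j i); congr nat_of_bool;
  by case: side => -[h h'] /=; rewrite ?h ?h' ?(ltW h) ?(ltW h') ?(lt_geF h) ?(lt_geF h') ?(lt_gtF h) ?(lt_gtF h').
Qed.

(** At levels below 1/2 a rejected p-value is below 1/2, and the estimated
    scale is calibrated so that p-value 1/2 corresponds to the median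
    absolute deviation.  If that deviation vanishes all p-values are 1. *)
Lemma plugin_BH_far a Y i : 0 < a < 2^-1 -> i \in plugin_BH n a Y ->
  median_abs_dev Y < `|tnth Y i - theta_est Y|.
Proof.
move=> /andP[a0 a2] iBH; have n0 : (0 < n)%N := leq_ltn_trans (leq0n _) (ltn_ord i).
have a01 : 0 < a <= 1 by apply/andP; split => //; lra.
have := BH_self_consistent a01 iBH; rewrite /pvalue.
have : a * #|plugin_BH n a Y|%:R / n%:R <= a.
  rewrite ler_pdivrMr ?ltr0n// ler_wpM2l ?(ltW a0)// ler_nat.
  by rewrite (leq_trans (max_card _))// card_ord.
rewrite -/(plugin_BH n a Y) => h1 h2.
have : normal_tail (`|tnth Y i - theta_est Y| / sigma_est Y) < normal_tail (normal_tail_inv (1 / 4)).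
  by rewrite normal_quartile_tail; lra.
rewrite normal_tail_ltE sigma_estE.
have q0 := normal_quartile_gt0; set q := normal_tail_inv _ in q0 *.
have := median_abs_dev_ge0 Y n0; rewrite le_eqVlt => /orP[/eqP <-|m0].
  by rewrite mul0r invr0 mulr0 ltNge (ltW q0).
by rewrite invf_div mulrA ltr_pdivlMr// mulrC ltr_pM2r.
Qed.

Definition moved_outward (t x x' : R) := (t < x /\ x <= x') \/ (x < t /\ x' <= x).

(** A rejected entry lies beyond the median absolute deviation, so pushing it
    further out on the same side leaves the median, then the deviations below
    their median, hence both estimators, unchanged; only its own p-value
    decreases.  This is what replaces independence between the estimators and
    the p-values. *)
Lemma plugin_BH_stable a Y Y' i : 0 < a < 2^-1 ->
  (forall j, j != i -> tnth Y' j = tnth Y j) ->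
  moved_outward (theta_est Y) (tnth Y i) (tnth Y' i) ->
  i \in plugin_BH n a Y -> plugin_BH n a Y' = plugin_BH n a Y.
Proof.
move=> a02 E side iBH; have far := plugin_BH_far a02 iBH.
have n0 : (0 < n)%N := leq_ltn_trans (leq0n _) (ltn_ord i).
have tE : theta_est Y' = theta_est Y.
  apply: (@median_move Y Y' i) => //.
  case: side => -[h h']; [left|right]; split => //.
    exact: lt_le_trans h h'.
  exact: le_lt_trans h' h.
have further : `|tnth Y i - theta_est Y| <= `|tnth Y' i - theta_est Y|.
  case: side => -[h h'].
    by rewrite !gtr0_norm ?subr_gt0// ?lerD2r// (lt_le_trans h).
  by rewrite !ltr0_norm ?subr_lt0// ?lerN2 ?lerD2r// (le_lt_trans h').
have mE : median_abs_dev Y' = median_abs_dev Y.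
  pose f y := `|y - theta_est Y|.
  rewrite /median_abs_dev tE -[LHS]/(median (map_tuple f Y')) -[RHS]/(median (map_tuple f Y)).
  apply: (@median_move _ _ i) => [j ji|].
    by rewrite !tnth_map E.
  left; rewrite !tnth_map /f; split => //.
  exact: lt_le_trans further.
have sE : sigma_est Y' = sigma_est Y by rewrite !sigma_estE mE.
have s0 : 0 <= sigma_est Y.
  by rewrite sigma_estE divr_ge0 ?median_abs_dev_ge0// ltW// normal_quartile_gt0.
rewrite /plugin_BH tE sE; apply: (@BH_stable _ _ _ _ _ _ _ i) => //.
- by case/andP: a02 => a0 a2; apply/andP; split => //; lra.
- by move=> j ji; rewrite /pvalue E.
- by rewrite /pvalue ler_pM2l// normal_tail_leE ler_wpM2r// invr_ge0.
Qed.

(** The key to the FDR bound: with the other coordinates fixed, the number of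
    rejections takes a single value over all the positions of coordinate i,
    on a given side of the estimated center, at which i is rejected. *)
Lemma plugin_BH_card_const a Y Y' i : 0 < a < 2^-1 ->
  (forall j, j != i -> tnth Y' j = tnth Y j) ->
  i \in plugin_BH n a Y -> i \in plugin_BH n a Y' ->
  (theta_est Y < tnth Y i /\ theta_est Y' < tnth Y' i) \/
  (tnth Y i < theta_est Y /\ tnth Y' i < theta_est Y') ->
  #|plugin_BH n a Y| = #|plugin_BH n a Y'|.
Proof.
wlog le : Y Y' / tnth Y i <= tnth Y' i => [hw a02 E iY iY' side|].
  have [le|/ltW le] := leP (tnth Y i) (tnth Y' i); first exact: hw.
  apply/esym/hw => //; first by move=> j /E.
  by case: side => -[? ?]; [left|right].
move=> a02 E iY iY' [[h h']|[h h']].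
  by rewrite (@plugin_BH_stable a Y Y' i)//; left.
by rewrite (@plugin_BH_stable a Y' Y i)//; [move=> j /E|right].
Qed.

End plugin_stability.

(** * Measurability *)

Section measurability.
Context {R : realType} (n : nat).
Implicit Types (a c : R) (u s : observation R n -> R) (i j : 'I_n).

Lemma measurable_natr_bool d (T : measurableType d) (b : T -> bool) :
  measurable_fun setT b -> measurable_fun setT (fun x => (b x)%:R : R).
Proof.
move=> mb; rewrite (_ : (fun x => _) = fun x => if b x then 1 else 0).
  exact: measurable_fun_ifT.
by apply/funext => x; case: (b x).
Qed.

Lemma measurable_coord i : measurable_fun setT (fun Y : observation R n => tnth Y i : R).
Proof. exact: measurable_tnth. Qed.

Lemma measurable_median (f : 'I_n -> observation R n -> R) :
  (forall i, measurable_fun setT (f i)) ->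
  measurable_fun setT (fun Y => median [tuple f i Y | i < n]).
Proof.
move=> mf; have [n0|n0] := posnP n.
  rewrite (_ : (fun Y => _) = cst 0)//; apply/funext => Y.
  by rewrite /median /order_stat nth_default// size_sort size_tuple n0.
apply: (measurability _ (RGenCInfty.measurableE R)) => //= _ [_ [c ->] <-].
rewrite setTI.
have cE Y : (c <= median [tuple f i Y | i < n]) =
    (\sum_(i < n) (f i Y < c)%R%:R <= (uphalf n).-1%:R :> R).
  rewrite le_median ?size_tuple// count_tuple -natr_sum ler_nat.
  rewrite (eq_bigr (fun i : 'I_n => nat_of_bool (f i Y < c))); last first.
    by move=> i _; rewrite tnth_mktuple.
  by rewrite -[in RHS]ltnS prednK// uphalf_half; lia.
rewrite (_ : _ @^-1` _ = [set Y | (\sum_(i < n) (f i Y < c)%R%:R <= (uphalf n).-1%:R :> R)]); last first.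
  by apply/seteqP; split => Y /=; rewrite in_itv/= andbT cE.
rewrite -[X in measurable X]setTI; apply: measurable_fun_le => //.
by apply: measurable_sum => i; apply: measurable_natr_bool; exact: measurable_fun_ltr.
Qed.

Lemma measurable_theta_est : measurable_fun setT (@theta_est R n).
Proof.
rewrite (_ : @theta_est R n = fun Y => median [tuple (tnth Y i : R) | i < n]).
  by apply: measurable_median => i; exact: measurable_coord.
apply/funext => Y; rewrite /theta_est; congr median.
by congr (tval _); apply: eq_from_tnth => j; rewrite tnth_mktuple.
Qed.

Lemma measurable_median_abs_dev : measurable_fun setT (@median_abs_dev R n).
Proof.
rewrite (_ : @median_abs_dev R n = fun Y => median [tuple `|tnth Y i - theta_est Y| | i < n]).
  apply: measurable_median => i; apply: measurableT_comp => //.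
  apply: measurable_funB; [exact: measurable_coord|exact: measurable_theta_est].
apply/funext => Y; rewrite /median_abs_dev; congr median.
have -> : [seq `|y - theta_est Y| | y : R <- Y] = map_tuple (fun y : R => `|y - theta_est Y|) Y by [].
by congr (tval _); apply: eq_from_tnth => j; rewrite tnth_mktuple tnth_map.
Qed.

Lemma measurable_sigma_est : measurable_fun setT (@sigma_est R n).
Proof.
rewrite (_ : @sigma_est R n = fun Y => median_abs_dev Y / normal_tail_inv (1 / 4))//.
by apply: measurable_funM => //; exact: measurable_median_abs_dev.
Qed.

(** P-values divide by the estimated scale, which vanishes on ties; the
    inverse of 0 is 0 here, as is the power of 0 with exponent -1. *)
Lemma measurable_sigma_est_inv : (0 < n)%N ->
  measurable_fun setT (fun Y => (@sigma_est R n Y)^-1).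
Proof.
move=> n0.
rewrite (_ : (fun Y => _) = fun Y => (@sigma_est R n Y) `^ (-1)); last first.
  apply/funext => Y; rewrite powR_inv1// sigma_estE divr_ge0 ?median_abs_dev_ge0//.
  exact/ltW/normal_quartile_gt0.
exact: (measurableT_comp (measurable_powR (-1)) measurable_sigma_est).
Qed.

Lemma measurable_pvalue u s i : measurable_fun setT u ->
  measurable_fun setT (fun Y => (s Y)^-1) ->
  measurable_fun setT (fun Y => pvalue Y (u Y) (s Y) i).
Proof.
move=> mu ms; apply: measurable_funM => //.
apply: (@measurableT_comp _ _ _ _ _ _ (@normal_tail R)).
  by apply: nonincreasing_measurable => // x y; exact: normal_tail_le.
apply: measurable_funM => //; apply: measurableT_comp => //.
by apply: measurable_funB => //; exact: measurable_coord.
Qed.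

(** The step-up description is a finite union of comparisons. *)
Lemma measurable_in_BH a u s i : 0 < a <= 1 -> measurable_fun setT u ->
  measurable_fun setT (fun Y => (s Y)^-1) ->
  measurable [set Y | i \in BH a Y (u Y) (s Y)].
Proof.
move=> a01 mu ms.
pose D m := [set Y : observation R n | m%:R <= \sum_(j < n) (pvalue Y (u Y) (s Y) j <= a * m%:R / n%:R)%R%:R :> R]
   `&` [set Y | pvalue Y (u Y) (s Y) i <= a * m%:R / n%:R].
rewrite (_ : [set Y | _] = \bigcup_(m in [set m | (0 < m <= n)%N]) D m).
  apply: bigcup_measurable => m _; apply: measurableI.
    rewrite -[X in measurable X]setTI; apply: measurable_fun_le => //.
    apply: measurable_sum => j; apply: measurable_natr_bool.
    by apply: measurable_fun_ler => //; exact: measurable_pvalue.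
  rewrite -[X in measurable X]setTI; apply: measurable_fun_le => //.
  exact: measurable_pvalue.
apply/seteqP; split => Y /=.
  move=> /(in_BHP _ _ _ _ a01)[m mn [mc pm]]; exists m => //; split => //=.
  by rewrite pcountE ler_nat.
case=> m /= mn [/=]; rewrite pcountE ler_nat => mc pm.
by apply/in_BHP => //; exists m.
Qed.

Lemma procedure_of_mem (r : observation R n -> {set 'I_n}) :
  (forall i, measurable [set Y | i \in r Y]) -> procedure r.
Proof.
move=> mr S.
rewrite (_ : _ @^-1` _ = \bigcap_(i in [set: 'I_n])
   (if i \in S then [set Y | i \in r Y] else ~` [set Y | i \in r Y])).
  apply: fin_bigcap_measurable => // i _; case: ifP => _ //.
  exact: measurableC.
apply/seteqP; split => Y /=.
  by move=> <- i _; case: ifPn => //= /negP.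
move=> h; apply/setP => i; have := h i Logic.I.
by case: (boolP (i \in S)) => _ //= /negP/negbTE.
Qed.

Lemma measurable_procedure (r : observation R n -> {set 'I_n}) (A : {set 'I_n} -> Prop) :
  procedure r -> measurable [set Y | A (r Y)].
Proof.
move=> mr.
rewrite (_ : [set Y | _] = \bigcup_(S in [set S | A S]) (r @^-1` [set S])).
  by apply: fin_bigcup_measurable => // S _; exact: mr.
apply/seteqP; split => Y /=; first by move=> h; exists (r Y).
by case=> S /= AS ->.
Qed.

Lemma procedure_pair (r r' : observation R n -> {set 'I_n})
    (A : {set 'I_n} -> {set 'I_n} -> Prop) :
  procedure r -> procedure r' -> measurable [set Y | A (r Y) (r' Y)].
Proof.
move=> mr mr'.
rewrite (_ : [set Y | _] = \bigcup_(S in [set: {set 'I_n}])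
   (r @^-1` [set S] `&` [set Y | A S (r' Y)])).
  apply: fin_bigcup_measurable => // S _; apply: measurableI; first exact: mr.
  exact: measurable_procedure.
apply/seteqP; split => Y /=; first by move=> h; exists (r Y).
by case=> S _ /= [<-].
Qed.

Lemma measurable_fun_procedure (r : observation R n -> {set 'I_n}) (h : {set 'I_n} -> R) :
  procedure r -> measurable_fun setT (fun Y => h (r Y)).
Proof.
move=> mr _ B mB; rewrite setTI.
exact: (@measurable_procedure _ (fun S => B (h S))).
Qed.

Lemma BH_procedure a u s : 0 < a <= 1 -> measurable_fun setT u ->
  measurable_fun setT (fun Y => (s Y)^-1) ->
  procedure (fun Y => BH a Y (u Y) (s Y)).
Proof. by move=> a01 mu ms; apply: procedure_of_mem => i; exact: measurable_in_BH. Qed.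

Lemma oracle_BH_procedure a (P : marginals n) : 0 < a <= 1 ->
  procedure (oracle_BH P a).
Proof. by move=> a01; apply: (BH_procedure a01); exact: measurable_cst. Qed.

Lemma plugin_BH_procedure a : 0 < a <= 1 -> procedure (@plugin_BH R n a).
Proof.
move=> a01; apply: procedure_of_mem => i.
apply: measurable_in_BH => //; first exact: measurable_theta_est.
by apply: measurable_sigma_est_inv; exact: leq_ltn_trans (ltn_ord i).
Qed.

End measurability.

(** * The null parameters *)

Section null_parameters.
Context {R : realType} (n : nat).
Implicit Types (P : @marginals R n) (m s : R).

Lemma in_normal_coordsP P m s i :
  reflect (has_normal_law (P i) m s) (i \in normal_coords P m s).
Proof. by rewrite inE; exact: asboolP. Qed.

(** Two strict majorities share a coordinate, and its law determines the
    couple. *)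
Lemma null_paramE P m s : is_null_param P (m, s) -> null_param P = (m, s).
Proof.
move=> [s0 h]; rewrite /null_param; case: xgetP => [[m' s'] _ [/= s0' h']|/(_ (m, s)) []//].
rewrite /= in s0 h.
have : normal_coords P m s :&: normal_coords P m' s' != finset.set0.
  rewrite -card_gt0; have := cardsUI (normal_coords P m s) (normal_coords P m' s').
  have : (#|normal_coords P m s :|: normal_coords P m' s'| <= n)%N.
    by rewrite -[X in (_ <= X)%N]card_ord max_card.
  have key (a b c d m0 : nat) : (m0 < 2 * a -> m0 < 2 * b -> c <= m0 ->
      c + d = a + b -> 0 < d)%N by lia.
  exact: key h h'.
case/set0Pn => i /finset.setIP[/in_normal_coordsP h1 /in_normal_coordsP h2].
have [|-> ->//] := @normal_prob_inj R m' s' m s s0' s0.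
by move=> A mA; rewrite -h1// -h2.
Qed.

Lemma null_param_in P : model P -> is_null_param P (theta P, sigma P).
Proof.
move=> [p hp]; rewrite /theta /sigma -surjective_pairing /null_param.
by case: xgetP => // /(_ p).
Qed.

Lemma pure_null_param m s : (0 < n)%N -> 0 < s ->
  is_null_param (fun _ : 'I_n => normal_prob m s : probability (measurableTypeR R) R)
    (m, s) /\
  H0 (fun _ : 'I_n => normal_prob m s : probability (measurableTypeR R) R) =
    [set: 'I_n]%SET.
Proof.
move=> n0 s0; set P := (fun _ => _).
have nc : normal_coords P m s = [set: 'I_n]%SET.
  by apply/setP => i; rewrite finset.in_setT; apply/in_normal_coordsP => A mA.
have np : is_null_param P (m, s).
  by split; [exact: s0|rewrite /= nc cardsT card_ord -{1}(mul1n n) ltn_pmul2r].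
by split; [exact: np|rewrite /H0 /theta /sigma (null_paramE np) nc].
Qed.

Lemma sparse_pure_null (k : R) m s : (0 < n)%N -> 0 <= k -> 0 < s ->
  sparse_model k (fun _ : 'I_n => normal_prob m s : probability (measurableTypeR R) R).
Proof.
move=> n0 k0 s0; have [np HT] := pure_null_param m n0 s0.
split; first by exists (m, s).
by rewrite /H1 HT finset.setCT cards0.
Qed.

End null_parameters.

(** * Two-sided normal tails *)

Section two_sided_tail.
Context {R : realType}.

Lemma measurable_two_sided (x : R) : measurable [set u : R | x < `|u|].
Proof.
rewrite (_ : [set u | _] = ~` ([set: R] `&` [set u : R | `|u| <= x])).
  by apply/measurableC/measurable_fun_le => //; exact: measurableT_comp.
by rewrite setTI; apply/seteqP; split => u /=; rewrite ltNge => /negP.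
Qed.

Lemma normal_prob_two_sided (x : R) : 0 <= x ->
  normal_prob 0 1 [set u : R | x < `|u|] = (2 * normal_tail x)%:E.
Proof.
move=> x0.
have -> : [set u : R | x < `|u|] = `]x, +oo[%classic `|` [set u | `]x, +oo[%classic (- u)].
  apply/seteqP; split => u /=; rewrite !in_itv/= !andbT.
    by rewrite lter_normr => /orP.
  by rewrite lter_normr => /orP.
have mo : measurable [set u : R | `]x, +oo[%classic (- u)].
  rewrite (_ : mkset _ = `]-oo, (- x)[%classic)//.
  by apply/seteqP; split => u /=; rewrite !in_itv/= andbT ltrNr.
rewrite [LHS]measureU//; last first.
  by apply/seteqP; split => u //= []; rewrite !in_itv/= !andbT; lra.
rewrite [X in (_ + X)%E]normal_probN// [X in (X + _)%E]normal_prob_oy [X in (_ + X)%E]normal_prob_oy.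
by rewrite -EFinD; congr EFin; lra.
Qed.

End two_sided_tail.

(** * A wide normal law as a contaminated standard one *)

Section contamination.
Context {R : realType}.
Implicit Types (x u : R).
Local Notation mu := (@lebesgue_measure R).
Variable p : R.
Hypothesis p01 : 0 < p < 1.

Let p0 : 0 < p. Proof. by case/andP: p01. Qed.
Let p1 : 0 < 1 - p. Proof. by rewrite subr_gt0; case/andP: p01. Qed.
Let p1n : (1 - p) != 0. Proof. by rewrite gt_eqF. Qed.
Let s : R := (1 - p)^-1.
Let s0 : 0 < s. Proof. by rewrite invr_gt0. Qed.

Lemma wide_normal_density u :
  normal_pdf 0 (1 - p)^-1 u =
  (1 - p) * expR (u ^+ 2 / 2 * (1 - (1 - p) ^+ 2)) * normal_pdf 0 1 u.
Proof.
rewrite !normal_pdfE ?gt_eqF//= (normal_peakE s0) /s invrK /normal_fun !subr0.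
rewrite -!mulrA; congr (_ * _); rewrite mulrCA; congr (_ * _).
rewrite -expRD; congr expR; rewrite expr1n exprVn.
by field.
Qed.

(** For p small the exponent in the density ratio is about p u ^ 2: the wide
    law has exponentially heavier tails.  At x = 0 this says that the wide
    density dominates 1 - p times the standard one, which is why the
    remainder is a positive measure. *)
Lemma wide_normal_density_ge x u : 0 <= x -> x <= `|u| ->
  (1 - p) * expR (p * x ^+ 2 / 2) * normal_pdf 0 1 u <= normal_pdf 0 (1 - p)^-1 u.
Proof.
move=> x0 xu; rewrite wide_normal_density ler_wpM2r ?normal_pdf_ge0//.
rewrite ler_wpM2l ?(ltW p1)// ler_expR.
have : x ^+ 2 <= u ^+ 2 by rewrite -(real_normK (num_real u)) lerXn2r ?nnegrE.
have := sqr_ge0 u; set a := x ^+ 2; set b := u ^+ 2 => b0 ab.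
have h1 : 0 <= p * (b - a) by rewrite mulr_ge0 ?subr_ge0// ltW// p0.
have h2 : 0 <= b * (p * (1 - p)) by rewrite mulr_ge0// mulr_ge0// ltW.
nra.
Qed.

Definition contaminant_density u : R :=
  (normal_pdf 0 (1 - p)^-1 u - (1 - p) * normal_pdf 0 1 u) / p.

Lemma contaminant_density_ge0 u : 0 <= contaminant_density u.
Proof.
rewrite divr_ge0 ?(ltW p0)// subr_ge0.
have := @wide_normal_density_ge 0 u (lexx _) (normr_ge0 _).
by rewrite expr0n/= mulr0 mul0r expR0 mulr1.
Qed.

(** The proof that 0 < p < 1 is an argument, so that the structure of a
    probability, which depends on it, can be attached to the function. *)
Definition contaminant of 0 < p < 1 := fun V : set (measurableTypeR R) =>
  (\int[mu]_(x in V) (contaminant_density x)%:E)%E.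

Let mcd (D : set R) : measurable_fun D (fun x : R => (contaminant_density x)%:E).
Proof.
apply/measurable_EFinP; apply: measurable_funTS; apply: measurable_funM => //.
apply: measurable_funB; first exact: measurable_normal_pdf.
by apply: measurable_funM => //; exact: measurable_normal_pdf.
Qed.

Lemma normal_prob_decomposition (A : set (measurableTypeR R)) : measurable A ->
  normal_prob 0 (1 - p)^-1 A = ((1 - p)%:E * normal_prob 0 1 A + p%:E * (contaminant p01) A)%E.
Proof.
move=> mA; rewrite /contaminant /normal_prob.
rewrite -ge0_integralZl//=; last 3 first.
- exact: measurable_EFin_normal_pdf.
- by move=> x _; rewrite lee_fin normal_pdf_ge0.
- by rewrite lee_fin ltW// p1.
rewrite -ge0_integralZl//=; last 3 first.
- exact: mcd.
- by move=> x _; rewrite lee_fin contaminant_density_ge0.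
- by rewrite lee_fin ltW// p0.
rewrite -ge0_integralD//=; last 4 first.
- by move=> x _; rewrite -EFinM lee_fin mulr_ge0 ?normal_pdf_ge0// ltW// p1.
- by apply: emeasurable_funM => //; exact: measurable_EFin_normal_pdf.
- by move=> x _; rewrite -EFinM lee_fin mulr_ge0 ?contaminant_density_ge0// ltW// p0.
- by apply: emeasurable_funM => //; exact: mcd.
apply: eq_integral => x _; rewrite -!EFinM -EFinD; congr EFin.
by rewrite /contaminant_density; field; rewrite gt_eqF// p0.
Qed.

Let contaminant0 : (contaminant p01) set0 = 0%E.
Proof. by rewrite /contaminant integral_set0. Qed.

Let contaminant_ge0 A : (0 <= (contaminant p01) A)%E.
Proof.
by rewrite /contaminant integral_ge0//= => x _; rewrite lee_fin contaminant_density_ge0.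
Qed.

Let contaminant_sigma_additive : semi_sigma_additive (contaminant p01).
Proof.
move=> /= A mA tA mUA; rewrite /contaminant ge0_integral_bigcup//=.
- by apply: is_cvg_ereal_nneg_natsum_cond => n _ _; exact: contaminant_ge0.
- exact: mcd.
- by move=> x _; rewrite lee_fin contaminant_density_ge0.
Qed.

HB.instance Definition _ := isMeasure.Build _ _ _
  (contaminant p01) contaminant0 contaminant_ge0 contaminant_sigma_additive.

Let contaminant_setT : (contaminant p01) setT = 1%E.
Proof.
have := @normal_prob_decomposition setT measurableT.
rewrite [X in X = _](@probability_setT _ _ _ (normal_prob 0 (1 - p)^-1)).
rewrite [X in (_ * X + _)%E](@probability_setT _ _ _ (normal_prob 0 1)).
have := contaminant_ge0 setT; case: ((contaminant p01) setT) => [r|_|//].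
  rewrite mule1 -EFinM -EFinD => _ [] h; congr EFin.
  have : p * r = p by lra.
  by move/(congr1 (fun z => z / p)); rewrite mulrC mulKf ?gt_eqF// mulfV ?gt_eqF ?p0.
by rewrite gt0_muley ?lte_fin ?p0// mule1 addey.
Qed.

HB.instance Definition _ :=
  @Measure_isProbability.Build _ _ R (contaminant p01) contaminant_setT.

Lemma integral_normal_decomposition (f : measurableTypeR R -> \bar R) :
  measurable_fun setT f -> (forall x, 0 <= f x)%E ->
  (\int[normal_prob 0 (1 - p)^-1]_x f x =
   (1 - p)%:E * \int[normal_prob 0 1]_x f x + p%:E * \int[(contaminant p01)]_x f x)%E.
Proof.
move=> mf f0.
pose m1 := [the measure _ _ of mscale (NngNum (ltW p1)) (normal_prob 0 1)].
pose m2 := [the measure _ _ of mscale (NngNum (ltW p0)) (contaminant p01)].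
rewrite (@eq_measure_integral _ _ _ _ (measure_add m1 m2)); last first.
  move=> A mA _; rewrite [RHS]measure_addE.
  exact: normal_prob_decomposition.
rewrite ge0_integral_measure_add//.
by rewrite !ge0_integral_mscale.
Qed.

(** Otherwise the mixture would be standard normal, while it has standard
    deviation 1 / (1 - p). *)
Lemma contaminant_not_normal : ~ has_normal_law (contaminant p01) 0 1.
Proof.
move=> h.
have [|_] := @normal_prob_inj R 0 (1 - p)^-1 0 1 s0 ltr01.
  move=> A mA; rewrite normal_prob_decomposition// h//.
  rewrite -ge0_muleDl ?lee_fin ?(ltW p0) ?(ltW p1)//.
  by rewrite -EFinD subrK mul1e.
move/eqP; rewrite invr_eq1 => /eqP h1; have := p0; lra.
Qed.

Lemma wide_normal_tail_ge x : 0 <= x ->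
  (((1 - p) * expR (p * x ^+ 2 / 2))%:E * normal_prob 0 1 [set u : R | (x < `|u|)%R] <=
   normal_prob 0 (1 - p)^-1 [set u : R | (x < `|u|)%R])%E.
Proof.
move=> x0.
have mA : measurable [set u : R | x < `|u|].
  exact: measurable_two_sided.
rewrite /normal_prob -ge0_integralZl//=; last 3 first.
- exact: measurable_EFin_normal_pdf.
- by move=> u _; rewrite lee_fin normal_pdf_ge0.
- by rewrite lee_fin mulr_ge0 ?expR_ge0// ltW// p1.
apply: ge0_le_integral => //=.
- move=> u _; rewrite -EFinM lee_fin mulr_ge0 ?normal_pdf_ge0//.
  by rewrite mulr_ge0 ?expR_ge0// ltW// p1.
- by apply: emeasurable_funM => //; exact: measurable_EFin_normal_pdf.
- exact: measurable_EFin_normal_pdf.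
- by move=> u xu; rewrite -EFinM lee_fin wide_normal_density_ge// ltW.
Qed.

End contamination.

(** * Lower bound at a fixed sample size *)

Section lower_bound.
Context {R : realType}.
Local Open Scope ereal_scope.

Lemma measurable_forall_coord n (A : 'I_n -> set R) : (forall i, measurable (A i)) ->
  measurable [set Y : observation R n | forall i, A i (tnth Y i)].
Proof.
move=> mA; rewrite (_ : mkset _ = \bigcap_(i in [set: 'I_n]) ((fun Y => tnth Y i : R) @^-1` A i)).
  apply: fin_bigcap_measurable => // i _; rewrite -[X in measurable X]setTI.
  exact: measurable_coord.
by apply/seteqP; split => Y /= h i => [_|]; exact: h.
Qed.

Lemma product_law_le n (P : @marginals R n) (A B : set (observation R n)) :
  measurable A -> measurable B -> A `<=` B -> product_law P A <= product_law P B.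
Proof. by move=> mA mB AB; apply: le_measure => //; rewrite inE. Qed.

Lemma product_law_setC n (P : @marginals R n) (A : set (observation R n)) :
  measurable A -> product_law P (~` A) = 1 - product_law P A.
Proof. exact: probability_setC. Qed.

Lemma FDP_le1 n (P : @marginals R n) S : (FDP P S <= 1)%R.
Proof.
rewrite /FDP ler_pdivrMr ?ltr0n ?leq_max ?orbT// mul1r ler_nat.
by rewrite (leq_trans (subset_leq_card (subsetIl _ _)))// leq_maxl.
Qed.

Lemma FDP_ge0 n (P : @marginals R n) S : (0 <= FDP P S)%R.
Proof. by rewrite divr_ge0. Qed.

(** When all hypotheses are true the false discovery proportion is 1 unless
    nothing is rejected. *)
Lemma FDR_pure_null n (P : @marginals R n) r : procedure r ->
  H0 P = [set: 'I_n]%SET -> product_law P [set Y | r Y != finset.set0] <= FDR P r.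
Proof.
move=> mr H0T; rewrite /FDR unlock.
have mE := @measurable_procedure R n r (fun S => S != finset.set0) mr.
rewrite -[X in product_law P X]setIT -integral_indic//.
apply: ge0_le_integral => //=.
- by apply/measurable_EFinP; exact: measurable_indic.
- by apply/measurable_EFinP; exact: (measurable_fun_procedure (FDP P)).
- move=> Y _; rewrite lee_fin indicE; case: (boolP (Y \in _)) => [|_]; last exact: FDP_ge0.
  rewrite inE /= => rY; rewrite /FDP H0T finset.setIT.
  have /maxn_idPl -> : (1 <= #|r Y|)%N by rewrite card_gt0.
  by rewrite divff// pnatr_eq0 -lt0n card_gt0.
Qed.

Lemma pow_one_sub_ge n (t : R) : (0 <= t <= 1 -> 1 - n%:R * t <= (1 - t) ^+ n)%R.
Proof.
move=> /andP[t0 t1]; elim: n => [|n IH]; first by rewrite mul0r subr0 expr0.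
rewrite exprS -addn1 natrD mulrDl mul1r.
have : ((1 - t) * (1 - n%:R * t) <= (1 - t) * (1 - t) ^+ n)%R.
  by rewrite ler_wpM2l// subr_ge0.
have : (0 <= n%:R * (t * t))%R by rewrite !mulr_ge0.
lra.
Qed.

Lemma pow_one_sub_le n (q : R) : (0 < n)%N ->
  (15 / n%:R <= q -> q <= 1 -> (1 - q) ^+ n <= 1 / 16)%R.
Proof.
move=> n0 q15 q1; apply: (@le_trans _ _ (expR (- q) ^+ n)%R).
  rewrite lerXn2r ?nnegrE ?expR_ge0 ?subr_ge0//; exact: expR_ge1Dx.
rewrite -expRM_natl; apply: (@le_trans _ _ (expR (- 15))).
  by rewrite ler_expR mulrN lerN2 mulrC -ler_pdivrMr ?ltr0n.
have h : (16 <= expR 15 :> R)%R by apply: le_trans (expR_ge1Dx _); lra.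
have e0 := @expR_gt0 R 15.
rewrite expRN ler_pdivlMr// mulrC ler_pdivrMr//; lra.
Qed.

(** The same data are explained by two models.  In the first one all entries
    are N(0, (1 - p)^-2) and every rejection is false, so r rejects nothing
    with high probability although some entry exceeds x in absolute value.
    In the second one the entries are standard normal nulls, which stay below
    x, plus about n p substitutes drawn from the contaminant; then the entry
    above x is a substitute which the oracle rejects and r misses.  The
    mixture decomposition identifies the two laws up to the choice of the
    labels. *)
Lemma lower_bound_finite n (k p x a e1 e2 : R) (r : observation R n -> {set 'I_n}) :
  (0 < n)%N -> (0 < k)%R -> (k < n%:R / 2)%R ->
  (0 < p < 1)%R -> (n%:R * p <= k / 8)%R ->
  (0 <= x)%R -> (2 * normal_tail x = (8 * n%:R)^-1)%R ->
  (15 <= (1 - p) * expR (p * x ^+ 2 / 2) / 8)%R ->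
  (8^-1 <= a <= 1)%R -> procedure r ->
  risk_I r k <= e1%:E -> (e1 <= 5 / 16)%R ->
  risk_II r k a <= e2%:E -> (e2 <= 1 / 16)%R -> False.
Proof.
move=> n0 k0 kn p01 npk x0 Qx M15 /andP[a8 a1] mr rI e1le rII e2le.
have n0' : (0 < n%:R :> R)%R by rewrite ltr0n.
have [p0 p1] := andP p01.
have s0 : (0 < (1 - p)^-1)%R by rewrite invr_gt0 subr_gt0.
pose N1 : probability (measurableTypeR R) R := normal_prob 0 1.
pose Ns : probability (measurableTypeR R) R := normal_prob 0 (1 - p)^-1.
pose B : probability (measurableTypeR R) R := contaminant p01.
(* Under the wide law every hypothesis is a true null, so that rejecting
   anything is a false discovery: r must be empty most of the time. *)
pose P2 : @marginals R n := fun _ => Ns.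
have [_ H02] := @pure_null_param R n 0%R _ n0 s0.
have sp2 := @sparse_pure_null R n k 0%R _ n0 (ltW k0) s0.
rewrite -/Ns -/P2 in H02 sp2.
pose E := [set Y : observation R n | r Y = finset.set0].
have mE : measurable E by exact: (@measurable_procedure _ _ r (fun S => S = finset.set0)).
have PE : (1 - e1)%:E <= product_law P2 E.
  have -> : E = ~` [set Y | r Y != finset.set0].
    by apply/seteqP; split => Y /=; [move=> ->; rewrite eqxx|move/negP; rewrite negbK => /eqP].
  rewrite product_law_setC; last exact: (@measurable_procedure _ _ r (fun S => S != finset.set0)).
  rewrite EFinB leeB//; apply: le_trans rI.
  apply: le_trans (FDR_pure_null mr H02) _.
  by apply: ereal_sup_ubound; exists P2.
pose far := [set u : R | (x < `|u|)%R].
have mfar : measurable far by exact: measurable_two_sided.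
have mnear : measurable (~` far) by exact: measurableC.
have N1near : N1 (~` far) = (1 - (8 * n%:R)^-1)%:E.
  rewrite [LHS]probability_setC//.
  by rewrite [X in (_ - X)]normal_prob_two_sided// Qx.
pose q := fine (Ns far).
have Nsq : Ns far = q%:E by rewrite fineK// fin_num_measure.
(* The heavier tail of the wide law makes some entry exceed x in absolute
   value with probability at least 15/16. *)
have q15 : (15 / n%:R <= q)%R.
  rewrite -lee_fin -Nsq (le_trans _ (wide_normal_tail_ge p01 x0))//.
  rewrite normal_prob_two_sided// Qx -EFinM lee_fin ler_pdivrMr//.
  apply: (le_trans M15); rewrite le_eqVlt; apply/orP; left; apply/eqP.
  by field; rewrite gt_eqF.
have q1 : (q <= 1)%R by rewrite -lee_fin -Nsq probability_le1.
have prodEFin (f : 'I_n -> R) : \prod_(i < n) (f i)%:E = (\prod_(i < n) f i)%R%:E.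
  by rewrite (big_morph EFin EFinM erefl).
pose G := [set Y : observation R n | forall i, (~` far) (tnth Y i)].
have mG : measurable G by exact: (measurable_forall_coord (A := fun _ => ~` far)).
have PG : product_law P2 G <= (1 / 16)%:E.
  rewrite /G (@product_lawE _ _ R n P2 (fun _ => ~` far))//.
  rewrite (eq_bigr (fun _ => (1 - q)%:E)); last first.
    by move=> i _; rewrite [LHS]probability_setC// [X in (_ - X)]Nsq.
  rewrite prodEFin lee_fin prodr_const card_ord.
  exact: pow_one_sub_le.
pose S := E `&` ~` G.
have mS : measurable S by apply: measurableI => //; exact: measurableC.
have PS : (10 / 16)%:E <= product_law P2 S.
  have : product_law P2 E <= product_law P2 S + product_law P2 G.
    apply: le_trans (measureU2 _ mS mG); apply: product_law_le => //.
      exact: measurableU.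
    by move=> Y EY; have [GY|nGY] := pselect (G Y); [right|left].
  move=> /(le_trans PE) h; have := le_trans h (leeD2l _ PG).
  have : product_law P2 S \is a fin_num by exact: fin_num_measure.
  move=> /fineK <-; rewrite -EFinD !lee_fin; lra.
(* The labels: with a cost 1 / k per label and n p <= k / 8, the label vector
   obtained has at most k labels and keeps S at probability at least 1/2. *)
have mf : measurable_fun setT (fun Y : observation R n => (\1_S Y : R)%:E).
  by apply/measurable_EFinP; exact: measurable_indic.
have [|||Y||L hL] := @mixture_derandomization _ _ R n N1 B Ns p k^-1
    (fun Y : observation R n => (\1_S Y : R)%:E).
- by rewrite !ltW.
- exact: integral_normal_decomposition.
- by [].
- by rewrite lee_fin.
- by move=> Y; rewrite lee_fin indicE; case: (_ \in _).
pose PL : @marginals R n := fun i => if L i then B else N1.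
have intS (Q : @marginals R n) : \int[product_law Q]_Y (\1_S Y : R)%:E = product_law Q S.
  by rewrite integral_indic// setIT.
rewrite !intS -/PL in hL.
pose LS := finset (fun i => L i).
have cardL : (\sum_i (L i)%:R = #|LS|%:R :> R)%R.
  rewrite -natr_sum; congr (_%:R)%R; rewrite -sum1_card [RHS]big_mkcond/=.
  by apply: eq_bigr => i _; rewrite inE; case: (L i).
rewrite cardL in hL.
have PLS : product_law PL S \is a fin_num by exact: fin_num_measure.
have PLS1 : product_law PL S <= 1 by exact: probability_le1.
have cpn : (k^-1 * (p * n%:R) <= 1 / 8)%R.
  by rewrite mulrC ler_pdivrMr// (mulrC p); lra.
have hL' := le_trans (leeD2r _ PS) hL.
have kL : (k^-1 * #|LS|%:R <= 1)%R.
  move: hL' PLS1; rewrite -(fineK PLS) -!EFinD !lee_fin; lra.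
have cL : (#|LS|%:R <= k)%R by move: kL; rewrite mulrC ler_pdivrMr// mul1r.
have PLS2 : (1 / 2)%:E <= product_law PL S.
  have : (0 <= k^-1 * #|LS|%:R)%R by rewrite mulr_ge0// invr_ge0 ltW.
  move: hL'; rewrite -(fineK PLS) -!EFinD !lee_fin; lra.
have ncL : normal_coords PL 0 1 = ~: LS.
  apply/setP => i; rewrite finset.in_setC (_ : (i \in LS) = L i); last by rewrite inE.
  case Li : (L i) => /=; last by apply/in_normal_coordsP => A mA; rewrite /PL Li.
  apply/negbTE/negP => /in_normal_coordsP; rewrite /PL Li => h.
  exact: (@contaminant_not_normal R p p01 h).
have npL : is_null_param PL (0, 1)%R.
  split; first exact: ltr01.
  have h : (2 * #|LS| < n)%N by rewrite -(ltr_nat R) natrM; lra.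
  rewrite /= ncL; move: h (cardsC LS); rewrite card_ord.
  by clear; move: #|LS| #|~: LS|; lia.
have EL := null_paramE npL.
have H1L : H1 PL = LS by rewrite /H1 /H0 /theta /sigma EL ncL finset.setCK.
have spL : sparse_model k PL by split; [exists (0, 1)%R|rewrite H1L].
have a01 : (0 < a <= 1)%R by apply/andP; split => //; lra.
have mo := oracle_BH_procedure PL a01.
pose TT := [set Y | (TDP PL (r Y) < TDP PL (oracle_BH PL a Y))%R].
have mTT : measurable TT.
  exact: (@procedure_pair _ _ r (oracle_BH PL a) (fun S S' => (TDP PL S < TDP PL S')%R)).
have PTT : product_law PL TT <= e2%:E.
  by apply: le_trans rII; apply: ereal_sup_ubound; exists PL.
(* F is the event that no true null of the labelled model exceeds x in
   absolute value; on F an entry that does carries a label. *)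
pose A i := if L i then [set: R] else ~` far.
have mA i : measurable (A i) by rewrite /A; case: (L i).
pose F := [set Y : observation R n | forall i, A i (tnth Y i)].
have mF : measurable F by exact: measurable_forall_coord.
have PF : (1 - 1 / 8)%:E <= product_law PL F.
  rewrite /F (@product_lawE _ _ R n PL A)//.
  rewrite (eq_bigr (fun i => (if L i then 1%R else (1 - (8 * n%:R)^-1)%R)%:E)); last first.
    move=> i _; rewrite /A /PL; case: (L i); last exact: N1near.
    exact: probability_setT.
  rewrite prodEFin lee_fin.
  have t0 : (0 <= (8 * n%:R)^-1 :> R)%R by rewrite invr_ge0.
  have t1 : ((8 * n%:R)^-1 <= 1 :> R)%R.
    rewrite invf_le1 ?mulr_gt0//; have : (1 <= n%:R :> R)%R by rewrite ler1n.
    lra.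
  apply: (@le_trans _ _ ((1 - (8 * n%:R)^-1) ^+ n)%R).
    apply: le_trans (pow_one_sub_ge n _); last by rewrite t0.
    by rewrite invfM mulrCA mulfV ?gt_eqF// mulr1 div1r.
  rewrite -[in leLHS](card_ord n) -prodr_const; apply: ler_prod => i _.
  by rewrite card_ord; case: (L i); rewrite subr_ge0 t1 ?lexx//= gerBl.
have sub : S `<=` TT `|` ~` F.
  move=> Y [EY nGY]; have [FY|nFY] := pselect (F Y); last by right.
  left; rewrite /TT/= EY /TDP finset.set0I cards0 mul0r divr_gt0 ?ltr0n ?leq_max ?orbT//.
  have [i] : exists i, far (tnth Y i).
    by apply: contrapT => h; apply: nGY => i fi; apply: h; exists i.
  move=> fi; apply/card_gt0P; exists i; rewrite inE; apply/andP; split; last first.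
    rewrite H1L inE; case Li : (L i) => //; have := FY i; rewrite /A Li; exact.
  (* A single p-value below a / n is rejected. *)
  apply/in_BHP => //; exists 1%N; first by rewrite n0.
  have pi : (pvalue Y (theta PL) (sigma PL) i <= a * 1%:R / n%:R)%R.
    rewrite /pvalue /theta /sigma EL/= subr0 divr1.
    apply: (@le_trans _ _ (2 * normal_tail x)%R).
      by rewrite ler_pM2l// normal_tail_leE ltW.
    rewrite Qx invfM mulr1 ler_wpM2r ?invr_ge0//; lra.
  by split => //; apply/card_gt0P; exists i; rewrite inE.
have : product_law PL S <= e2%:E + (1 / 8)%:E.
  apply: (@le_trans _ _ (product_law PL TT + product_law PL (~` F))).
    apply: le_trans (measureU2 _ mTT (measurableC mF)); apply: product_law_le => //.
    by apply: measurableU => //; exact: measurableC.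
  apply: leeD => //; rewrite product_law_setC//.
  have : product_law PL F \is a fin_num by exact: fin_num_measure.
  by move=> /fineK E3; move: PF; rewrite -E3 -EFinB !lee_fin; lra.
by move=> /(le_trans PLS2); rewrite -EFinD lee_fin; lra.
Qed.

End lower_bound.

(** * Impossibility above the threshold *)

Section impossibility.
Context {R : realType}.

Lemma limn_esup_near_lt (u : nat -> \bar R) (c : \bar R) :
  (limn_esup u < c)%E -> \forall n \near \oo, (u n < c)%E.
Proof.
rewrite /limn_esup limf_esupE => /ereal_inf_lt[_ [V oV <-]] Vc.
apply: filterS oV => n Vn; apply: le_lt_trans Vc.
by apply: ereal_sup_ubound; exists n.
Qed.

Lemma cvg0_near_lt (u : nat -> \bar R) (c : R) : 0 < c ->
  u @ \oo --> 0%E -> \forall n \near \oo, (u n < c%:E)%E.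
Proof.
move=> c0 u0; apply: (u0 [set y | (y < c%:E)%E]); apply: open_nbhs_nbhs.
by split; [exact: open_ereal_lt_ereal|rewrite /= lte_fin].
Qed.

(** The normal quantile at level 1 / (16 n) is at least of order sqrt (ln n):
    the mass of [x, x + 1] is at least the density at x + 1. *)
Lemma tail_quantile_ge (n : nat) (x : R) : 4 <= ln n%:R :> R ->
  1 <= n%:R * normal_density 0 ^+ 2 :> R -> 0 <= x ->
  normal_tail x = (16 * n%:R)^-1 -> ln n%:R / 4 <= x ^+ 2.
Proof.
move=> ln4 nphi x0 Qx.
have n0 : 0 < n%:R :> R.
  by rewrite ltNge; apply/negP => /ln0 h; move: ln4; rewrite h; lra.
have p0 := @normal_density0_gt0 R.
have h1 : normal_density (x + 1) <= (16 * n%:R)^-1.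
  rewrite -Qx; have := @normal_tail_sub_lb R x (x + 1).
  rewrite x0 lerDl ler01 => /(_ isT); rewrite addrAC subrr add0r mul1r => /le_trans; apply.
  by rewrite gerBl normal_tail_ge0.
suff : ln n%:R <= (x + 1) ^+ 2 by nra.
rewrite leNgt; apply/negP => h2.
have h3 : expR ((x + 1) ^+ 2) < n%:R.
  by rewrite -[ltRHS]lnK ?posrE// ltr_expR.
have h4 : 16 * n%:R * normal_density 0 <= expR ((x + 1) ^+ 2 / 2).
  move: h1; rewrite normal_densityE mulNr expRN ler_pdivrMr ?expR_gt0//.
  by rewrite mulrC ler_pdivlMr ?mulr_gt0// mulrC.
have h5 : expR ((x + 1) ^+ 2 / 2) ^+ 2 = expR ((x + 1) ^+ 2).
  by rewrite -expRM_natl; congr expR; lra.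
have h6 : 0 <= 16 * n%:R * normal_density 0 :> R by rewrite !mulr_ge0// ltW.
have h7 : (16 * n%:R * normal_density 0) ^+ 2 <= expR ((x + 1) ^+ 2).
  by rewrite -h5 lerXn2r ?nnegrE// ?expR_ge0.
move: h7 h3 nphi n0; clear.
set e := expR _; set N := n%:R; set f := normal_density 0 => h7 h3 nphi n0.
have : 16 * 16 * N * (N * f ^+ 2) <= e.
  by move: h7; rewrite !exprMn; lra.
nra.
Qed.

(** With K the sparsity, N the sample size, L its logarithm and p = K / (8
    N), the exponent p x ^ 2 / 2 is at least 127 because K L dominates N.
    Since 128 <= 1 + 127 and p <= 1/16, the last bound is 15/16 * 128 / 8 =
    15. *)
Lemma contamination_strength (N K L x2 : R) : 0 < N -> 0 < K -> K < N / 2 ->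
  4 <= L -> N / L <= (64 * 127)^-1 * K -> L / 4 <= x2 ->
  [/\ 0 < K / (8 * N) < 1, N * (K / (8 * N)) <= K / 8 &
      15 <= (1 - K / (8 * N)) * expR (K / (8 * N) * x2 / 2) / 8].
Proof.
move=> N0 K0 KN L4 NL Lx.
have p0 : 0 < K / (8 * N) by rewrite divr_gt0 ?mulr_gt0.
have p16 : K / (8 * N) <= 1 / 16 by rewrite ler_pdivrMr ?mulr_gt0//; lra.
have px : 2 * 127 <= K / (8 * N) * x2.
  have : K / (8 * N) * (L / 4) <= K / (8 * N) * x2 by rewrite ler_pM2l.
  apply: le_trans.
  move: NL; rewrite ler_pdivrMr; last by lra.
  move=> NL; rewrite mulrAC ler_pdivlMr ?mulr_gt0//.
  have : 64 * 127 * N <= K * L by rewrite -ler_pdivlMl ?mulr_gt0// mulrA.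
  lra.
have NE : N * (K / (8 * N)) = K / 8 by field; rewrite gt_eqF.
move: p0 p16 px NE; set p := K / _ => p0 p16 px NE.
split; [by apply/andP; split; lra|by rewrite NE|].
have e1 : 128 <= expR (p * x2 / 2) by apply: le_trans (expR_ge1Dx _); lra.
have : 15 / 16 * 128 <= (1 - p) * expR (p * x2 / 2) by rewrite ler_pM//; lra.
lra.
Qed.

(** Level 1/4 suffices to contradict optimality.  The margin 1/16 is added to
    the type I bound, and eta n <= 1/2 keeps the oracle level above 1/8. *)
Lemma AMO_near_quarter (k : nat -> R) (r : forall n, R -> observation R n -> {set 'I_n}) :
  AMO k r -> \forall n \near \oo, exists a : R,
    [/\ 8^-1 <= a <= 1, procedure (r n (4^-1)%R),
        (risk_I (r n (4^-1)%R) (k n) <= (5 / 16)%R%:E)%E &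
        (risk_II (r n (4^-1)%R) (k n) a <= (1 / 16)%R%:E)%E].
Proof.
move=> [mr [eta [eta0 etacvg hI hII]]].
have c16 : 0 < 1 / 16 :> R by lra.
have c16e : (0%E < (1 / 16 : R)%R%:E)%E by rewrite lte_fin.
have nearI := limn_esup_near_lt (le_lt_trans hI c16e).
have nearII := cvg0_near_lt c16 hII.
have neareta : \forall n \near \oo, eta n < 2^-1 by apply: (cvgr_lt 0 etacvg); lra.
have near5 := @nbhs_infty_ger R 5.
near=> n.
have n5 : 5 <= n%:R :> R by near: n.
have eta_n : eta n < 2^-1 by near: n.
have a_in : [set a : R | (n%:R^-1 < a < 2^-1)%R] 4^-1.
  by move: n5; clear => n5; apply/andP; split; rewrite ltf_pV2 ?posrE; lra.
exists (4^-1 * (1 - eta n)); split.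
- have := eta0 n; move: eta_n; clear; set e := eta n => e2 e0.
  by apply/andP; split; lra.
- by apply: mr; clear; apply/andP; split; lra.
- have : (risk_I (r n (4^-1)%R) (k n) - (4^-1)%R%:E <= (1 / 16)%R%:E)%E.
    apply: (@le_trans _ _ (ereal_sup [set risk_I (r n a) (k n) - a%:E
      | a in [set a : R | (n%:R^-1 < a < 2^-1)%R]])%E); last by apply: ltW; near: n.
    by apply: ereal_sup_ubound; exists (4^-1)%R.
  rewrite leeBlDr// -EFinD => /le_trans; apply; rewrite lee_fin; clear; lra.
- apply: (@le_trans _ _ (ereal_sup [set risk_II (r n a) (k n) (a * (1 - eta n))%R
      | a in [set a : R | (n%:R^-1 < a < 2^-1)%R]])%E); last by apply: ltW; near: n.
  by apply: ereal_sup_ubound; exists (4^-1)%R.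
Unshelve. all: by end_near. Qed.

Lemma AMO_impossible (k : nat -> R) : sparsity_sequence k ->
  (fun n : nat => n%:R / ln n%:R : R) =o_\oo k ->
  ~ exists r : forall n, R -> observation R n -> {set 'I_n}, AMO k r.
Proof.
move=> hk /eqoP hlk [r /AMO_near_quarter nearr].
have eps0 : 0 < (64 * 127)^-1 :> R by rewrite invr_gt0 mulr_gt0.
have nearlk := hlk _ eps0.
have nearln := @nbhs_infty_ger R (expR 4).
have nearphi := @nbhs_infty_ger R ((normal_density 0 ^+ 2)^-1).
have near5 := @nbhs_infty_ger R 5.
near \oo => n.
have n5 : 5 <= n%:R :> R by near: n.
have [a [a01 mrn rI rII]] : exists a : R,
    [/\ 8^-1 <= a <= 1, procedure (r n (4^-1)%R),
        (risk_I (r n (4^-1)%R) (k n) <= (5 / 16)%R%:E)%E &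
        (risk_II (r n (4^-1)%R) (k n) a <= (1 / 16)%R%:E)%E] by near: n.
have n0' : 0 < n%:R :> R by apply: lt_le_trans n5.
have n0 : (0 < n)%N by rewrite -(ltr_nat R).
have n2 : (2 < n)%N by rewrite -(ltr_nat R) (lt_le_trans _ n5)// ltr_nat.
have /andP[k1 k2] := hk n n2.
have k0 : 0 < k n by apply: lt_le_trans k1.
have ln4 : 4 <= ln n%:R :> R.
  by rewrite -[leLHS]expRK ler_ln ?posrE ?expR_gt0//; near: n.
have phin : 1 <= n%:R * normal_density 0 ^+ 2 :> R.
  rewrite -ler_pdivrMr ?div1r; first by near: n.
  by rewrite exprn_gt0// normal_density0_gt0.
have lk : n%:R / ln n%:R <= (64 * 127)^-1 * k n.
  have h : `|n%:R / ln n%:R| <= (64 * 127)^-1 * `|k n| by near: n.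
  by rewrite (le_trans (ler_norm _))// (le_trans h)// gtr0_norm.
have [x x0 Qx] : exists2 x : R, 0 <= x & normal_tail x = (16 * n%:R)^-1.
  apply: normal_tail_surj; first by rewrite invr_gt0 mulr_gt0.
  by rewrite lef_pV2 ?posrE ?mulr_gt0//; move: n5; clear; lra.
have x2 := tail_quantile_ge ln4 phin x0 Qx.
have [p01 Np M15] := contamination_strength n0' k0 k2 ln4 lk x2.
apply: (@lower_bound_finite R n (k n) _ x a (5 / 16) (1 / 16) (r n (4^-1)%R) n0 k0 k2 p01 Np x0 _ M15) => //.
by rewrite Qx; field; rewrite gt_eqF.
Unshelve. all: by end_near. Qed.

End impossibility.

(** * Perturbation of the p-values *)

Section pvalue_comparison.
Context {R : realType}.
Implicit Types (x y u s d X t : R).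

Lemma standardized_le x d : 0 <= x -> 0 <= d <= 2^-1 ->
  (x + d) / (1 - d) <= x + 2 * d * (1 + x).
Proof.
move=> x0 /andP[d0 d2]; rewrite ler_pdivrMr; last by lra.
have : 0 <= (d * (1 + x)) * (1 - 2 * d) by rewrite !mulr_ge0//; lra.
lra.
Qed.

(** Relative errors of size d on center and scale move a standardized
    deviation x by at most 2 d (1 + x), in both directions. *)
Lemma standardized_perturb y u s u' s' d : 0 < s -> 0 <= d <= 2^-1 ->
  `|u' - u| <= d * s -> `|s' - s| <= d * s ->
  `|y - u'| / s' <= `|y - u| / s + 2 * d * (1 + `|y - u| / s) /\
  `|y - u| / s <= `|y - u'| / s' + 2 * d * (1 + `|y - u'| / s').
Proof.
move=> s0 d02 hu; rewrite ler_norml => /andP[hs1 hs2]; have /andP[d0 d2] := d02.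
have s'0 : 0 < s' by nra.
have h1 : `|y - u'| <= `|y - u| + d * s.
  have -> : y - u' = (y - u) - (u' - u) by ring.
  by rewrite (le_trans (ler_normB _ _))// lerD2l.
have h2 : `|y - u| <= `|y - u'| + d * s.
  have -> : y - u = (y - u') + (u' - u) by ring.
  by rewrite (le_trans (ler_normD _ _))// lerD2l.
have p1 := normr_ge0 (y - u); have p2 := normr_ge0 (y - u').
move: p1 p2 h1 h2; clear hu; set v := `|y - u|; set v' := `|y - u'|.
move=> v0 v'0 h1 h2; split.
  apply: le_trans (standardized_le (divr_ge0 v0 (ltW s0)) d02).
  rewrite ler_pdivrMr// mulrAC ler_pdivlMr; last by lra.
  have -> : (v / s + d) * s' = (v + d * s) * (s' / s) by field; rewrite gt_eqF.
  have h3 : 1 - d <= s' / s by rewrite ler_pdivlMr//; lra.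
  rewrite (le_trans (ler_wpM2r _ h1))//; first by lra.
  by rewrite ler_wpM2l// addr_ge0// mulr_ge0// ltW.
rewrite ler_pdivrMr//.
have w0 : 0 <= v' / s' by rewrite divr_ge0// ltW.
have e : v' = (v' / s') * s' by rewrite divfK// gt_eqF.
move: e w0 h2; set w := v' / s' => e w0 h2; rewrite e in h2.
have h3 : w * s' <= w * (s + d * s) by rewrite ler_wpM2l//; lra.
have h4 : 0 <= d * s by rewrite mulr_ge0// ltW.
have h5 : 0 <= w * (d * s) by rewrite mulr_ge0.
nra.
Qed.

(** Relative loss on a normal tail when a deviation x <= X moves by 2 d (1 +
    x); it is of order d X ^ 2. *)
Definition tail_loss d X : R := expR 2 * (2 * d) * (1 + X) ^+ 2.

Lemma tail_loss_ge0 d X : 0 <= d -> 0 <= tail_loss d X.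
Proof. by move=> d0; rewrite /tail_loss mulr_ge0 ?sqr_ge0// mulr_ge0 ?expR_ge0// mulr_ge0. Qed.

Lemma normal_tail_perturb x x' d X : 0 <= x -> x <= X -> 0 <= d ->
  x' <= x + 2 * d * (1 + x) ->
  normal_tail x * (1 - tail_loss d X) <= normal_tail x'.
Proof.
move=> x0 xX d0 xx'.
have h0 : 0 <= 2 * d * (1 + x) by rewrite !mulr_ge0//; lra.
apply: le_trans (normal_tail_le xx').
have := @normal_tail_shift R x (x + 2 * d * (1 + x)).
rewrite x0 lerDl h0 => /(_ isT); apply: le_trans.
rewrite ler_wpM2l ?normal_tail_ge0// lerD2l lerN2 addrAC subrr add0r.
rewrite /tail_loss -!mulrA ler_wpM2l ?expR_ge0// (mulrCA (x + 1)) ler_wpM2l//.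
rewrite (mulrCA (x + 1)) ler_wpM2l// expr2 (addrC x) ler_pM//; lra.
Qed.

(** Deviations beyond X are harmless because X is so large that their p-value
    is below every critical level t. *)
Lemma pvalue_perturb x x' d X t : 0 <= x -> 0 <= d ->
  x' <= x + 2 * d * (1 + x) ->
  2 * normal_tail X <= t -> 2 * normal_tail x' <= t ->
  2 * normal_tail x * (1 - tail_loss d X) <= t.
Proof.
move=> x0 d0 xx' Xt x't; have [xX|Xx] := leP x X.
  have := normal_tail_perturb x0 xX d0 xx'; lra.
have h1 := normal_tail_le (ltW Xx); have h2 := tail_loss_ge0 X d0.
have h3 := normal_tail_ge0 x.
have : 0 <= normal_tail x * tail_loss d X by rewrite mulr_ge0.
lra.
Qed.

End pvalue_comparison.

(** * Comparison of the plug-in and oracle procedures *)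

Section plugin_vs_oracle.
Context {R : realType} (n : nat).
Implicit Types (P : @marginals R n) (Y : observation R n) (a d X : R) (i : 'I_n).

Definition accurate P d Y : Prop :=
  `|theta_est Y - theta P| <= d * sigma P /\ `|sigma_est Y - sigma P| <= d * sigma P.

Lemma sigma_gt0 P : model P -> 0 < sigma P.
Proof. by move/null_param_in => []. Qed.

Lemma TDP_le P (S S' : {set 'I_n}) : S \subset S' -> TDP P S <= TDP P S'.
Proof.
move=> h; apply: ler_wpM2r; first by rewrite invr_ge0.
by rewrite ler_nat; apply: subset_leq_card; apply: finset.setSI.
Qed.

Variables (P : @marginals R n) (a d X : R).
Hypotheses (mP : model P) (a01 : n%:R^-1 < a < 2^-1) (d02 : 0 <= d <= 2^-1).
Hypotheses (loss1 : tail_loss d X < 1) (X0 : 2 * normal_tail X <= n%:R^-1 ^+ 2).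
Local Notation kap := (tail_loss d X).

Let s0 : 0 < sigma P. Proof. exact: sigma_gt0. Qed.
Let a0 : 0 < a.
Proof. by case/andP: a01 => h _; rewrite (le_lt_trans _ h)// invr_ge0. Qed.
Let kap0 : 0 <= kap. Proof. by apply: tail_loss_ge0; case/andP: d02. Qed.

Let level_ge m : (0 < n)%N -> (0 < m)%N -> n%:R^-1 ^+ 2 <= a * m%:R / n%:R.
Proof.
move=> n0 m0; rewrite expr2 ler_wpM2r ?invr_ge0//.
case/andP: a01 => h _; rewrite -[leLHS]mulr1 ler_pM ?invr_ge0//; first exact: ltW.
by rewrite ler1n.
Qed.

(** Multiplying the level by 1 - kap absorbs the perturbation of the p-values
    at every critical level of the step-up procedure. *)
Lemma oracle_sub_plugin Y : accurate P d Y ->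
  oracle_BH P (a * (1 - kap)) Y \subset plugin_BH n a Y.
Proof.
move=> [ht hs]; apply/fintype.subsetP => i.
have n0 : (0 < n)%N := leq_ltn_trans (leq0n _) (ltn_ord i).
have k1 : 0 < 1 - kap by rewrite subr_gt0.
have a01' : 0 < a <= 1 by case/andP: a01 => _ h; rewrite a0/=; lra.
have ak : 0 < a * (1 - kap) <= 1.
  rewrite mulr_gt0//=; have /andP[_ h] := a01'.
  have := mulr_ge0 (ltW a0) kap0; lra.
have key m j : (0 < m)%N ->
    pvalue Y (theta P) (sigma P) j <= a * (1 - kap) * m%:R / n%:R ->
    pvalue Y (theta_est Y) (sigma_est Y) j <= a * m%:R / n%:R.
  move=> m0 hp; have Xt := le_trans X0 (level_ge n0 m0).
  have [_ h2] := standardized_perturb (tnth Y j) s0 d02 ht hs.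
  have [xX|Xx] := leP (`|tnth Y j - theta_est Y| / sigma_est Y) X; last first.
    apply: le_trans Xt; rewrite /pvalue ler_pM2l//; exact/normal_tail_le/ltW.
  have x0 : 0 <= `|tnth Y j - theta_est Y| / sigma_est Y.
    rewrite divr_ge0// sigma_estE divr_ge0 ?median_abs_dev_ge0// ltW//.
    exact: normal_quartile_gt0.
  have := normal_tail_perturb x0 xX (proj1 (andP d02)) h2.
  move: hp; rewrite /pvalue; set q1 := normal_tail _; set q2 := normal_tail _ => hp hq.
  have : 2 * q2 * (1 - kap) <= a * m%:R / n%:R * (1 - kap).
    rewrite (_ : a * m%:R / n%:R * (1 - kap) = a * (1 - kap) * m%:R / n%:R); last by ring.
    by apply: le_trans hp; rewrite -mulrA ler_wpM2l.
  by rewrite ler_pM2r.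
move=> /(in_BHP _ _ _ _ ak)[m /andP[m0 mn] [mc pm]]; apply/in_BHP => //.
exists m; first by rewrite m0.
split; last exact: key.
rewrite (leq_trans mc)//; apply: subset_leq_card; apply/fintype.subsetP => j.
by rewrite !inE; exact: key.
Qed.

Lemma TDP_plugin_ge Y : accurate P d Y ->
  TDP P (oracle_BH P (a * (1 - kap)) Y) <= TDP P (plugin_BH n a Y).
Proof.
by move=> /oracle_sub_plugin; exact: TDP_le.
Qed.

Lemma oracle_pvalue_le Y i : accurate P d Y -> i \in plugin_BH n a Y ->
  2 * normal_tail (`|tnth Y i - theta P| / sigma P) * (1 - kap) <=
  a * #|plugin_BH n a Y|%:R / n%:R.
Proof.
move=> [ht hs] iBH.
have n0 : (0 < n)%N := leq_ltn_trans (leq0n _) (ltn_ord i).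
have a01' : 0 < a <= 1 by case/andP: a01 => _ h; rewrite a0/=; lra.
have [h1 _] := standardized_perturb (tnth Y i) s0 d02 ht hs.
apply: pvalue_perturb h1 _ _.
- by rewrite divr_ge0// ltW.
- by case/andP: d02.
- apply: le_trans X0 (level_ge n0 _).
  by apply/card_gt0P; exists i.
- exact: BH_self_consistent.
Qed.

Hypothesis dq : 2 * d <= normal_tail_inv (1 / 4).

(** The sides of a rejected entry with respect to the true and the estimated
    centers coincide, because the estimation error is smaller than the median
    absolute deviation, which a rejected entry exceeds. *)
Lemma rejected_side Y i : accurate P d Y -> i \in plugin_BH n a Y ->
  (theta P < tnth Y i -> theta_est Y < tnth Y i) /\
  (tnth Y i <= theta P -> tnth Y i < theta_est Y).
Proof.
move=> [ht hs] iBH.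
have a02 : 0 < a < 2^-1 by rewrite a0; case/andP: a01.
have := plugin_BH_far a02 iBH.
have q0 := @normal_quartile_gt0 R.
have : median_abs_dev Y = sigma_est Y * normal_tail_inv (1 / 4).
  by rewrite sigma_estE divfK// gt_eqF.
move: ht hs dq q0 s0 d02.
set t := theta P; set t' := theta_est Y; set q := normal_tail_inv _; set s := sigma P.
set s' := sigma_est Y; set y := tnth Y i => ht hs hq q0 s1 /andP[d0 d2] ->.
move: ht hs; rewrite !ler_norml => /andP[ht1 ht2] /andP[hs1 hs2] far.
have hh : d * s < `|y - t'|.
  apply: le_lt_trans far.
  have h1 : 2^-1 * s <= s' by nra.
  have h2 : 2^-1 * s * q <= s' * q by rewrite ler_pM2r.
  nra.
split => h; rewrite ltNge; apply/negP => h'.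
  by move: hh; rewrite ler0_norm ?subr_le0//; lra.
by move: hh; rewrite ger0_norm ?subr_ge0//; lra.
Qed.

End plugin_vs_oracle.

(** * False discovery rate of the plug-in procedure *)

Section FDR_bound.
Context {R : realType}.
Implicit Types (d w : R).

(** A positive deviation z with two-sided p-value at most w is beyond a
    quantile of mass w / 2.  For w >= 1 the quantile is replaced with 0,
    which keeps the mass at most w / 2. *)
Lemma small_pvalue_cover w : 0 <= w -> exists B : set R,
  [/\ measurable B, (normal_prob 0 1 B <= (w / 2)%:E)%E &
      forall z, 0 <= z -> 2 * normal_tail z <= w -> B z].
Proof.
move=> w0; have [w1|w1] := leP 1 w.
  exists `[0, +oo[%classic; split => //.
    by rewrite normal_prob_cy normal_tail0 lee_fin; lra.
  by move=> z z0 _; rewrite /= in_itv/= z0.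
move: w0; rewrite le_eqVlt => /orP[/eqP <-|w0].
  exists set0; split => //; first by rewrite measure0 mul0r.
  by move=> z _; have := normal_tail_gt0 z; lra.
have [||z0 z00 Qz0] := @normal_tail_surj R (w / 2); [lra..|].
exists `[z0, +oo[%classic; split => //.
  by rewrite normal_prob_cy Qz0.
move=> z _ h; rewrite /= in_itv/= andbT -normal_tail_leE Qz0; lra.
Qed.

Variables (n : nat) (P : @marginals R n).
Hypothesis mP : model P.
Let s0 : 0 < sigma P. Proof. exact: sigma_gt0. Qed.

Lemma H0_law i (A : set R) : i \in H0 P -> measurable A ->
  P i A = normal_prob 0 1 [set z : R | A (theta P + sigma P * z)].
Proof.
by move=> /in_normal_coordsP h mA; rewrite h// normal_prob_affine.
Qed.

Lemma right_pvalue_cover i w : i \in H0 P -> 0 <= w -> exists C : set R,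
  [/\ measurable C, (P i C <= (w / 2)%:E)%E &
      forall y, theta P < y -> 2 * normal_tail (`|y - theta P| / sigma P) <= w -> C y].
Proof.
move=> iH w0; have [B [mB NB hB]] := small_pvalue_cover w0.
exists [set y : R | B ((y - theta P) / sigma P)].
have mC : measurable [set y : R | B ((y - theta P) / sigma P)].
  rewrite -[X in measurable X]setTI.
  apply: (_ : measurable_fun setT (fun y : R => (y - theta P) / sigma P)) => //.
  by apply: measurable_funM => //; exact: measurable_funB.
split => //.
  rewrite H0_law//; congr (_ <= _)%E: NB; congr (normal_prob 0 1 _).
  apply/seteqP; split => z /=;
    by rewrite addrAC subrr add0r mulrC mulKf ?gt_eqF.
move=> y ty; rewrite gtr0_norm ?subr_gt0//; apply: hB.
by rewrite divr_ge0 ?ltW// subr_gt0.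
Qed.

Lemma left_pvalue_cover i w : i \in H0 P -> 0 <= w -> exists C : set R,
  [/\ measurable C, (P i C <= (w / 2)%:E)%E &
      forall y, y <= theta P -> 2 * normal_tail (`|y - theta P| / sigma P) <= w -> C y].
Proof.
move=> iH w0; have [B [mB NB hB]] := small_pvalue_cover w0.
exists [set y : R | B (- ((y - theta P) / sigma P))].
have mC : measurable [set y : R | B (- ((y - theta P) / sigma P))].
  rewrite -[X in measurable X]setTI.
  apply: (_ : measurable_fun setT (fun y : R => - ((y - theta P) / sigma P))) => //.
  apply: measurableT_comp => //.
  by apply: measurable_funM => //; exact: measurable_funB.
split => //.
  rewrite H0_law//; move: NB; rewrite -normal_probN//; congr (_ <= _)%E; congr (normal_prob 0 1 _).
  apply/seteqP; split => z /=;
    by rewrite addrAC subrr add0r (mulrC (sigma P)) mulfK ?gt_eqF.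
move=> y ty; rewrite ler0_norm ?subr_le0// mulNr; apply: hB.
by rewrite oppr_ge0 mulr_le0_ge0 ?subr_le0// invr_ge0 ltW.
Qed.

(** On one side of the center the number of rejections is a constant N while
    i is rejected, and being rejected implies that the p-value is at most c
    N; so the mean of the indicator divided by N is at most (c N / 2) / N.
    The factor 1/2 is that of a single side. *)
Lemma one_sided_weight i (side good : R -> Prop) (N : R -> nat) (c : R) : 0 <= c ->
  (forall y, good y -> (0 < N y)%N) ->
  (forall y y', side y -> side y' -> good y -> good y' -> N y = N y') ->
  (forall y, side y -> good y ->
    2 * normal_tail (`|y - theta P| / sigma P) <= c * (N y)%:R) ->
  (forall w, 0 <= w -> exists C : set R, [/\ measurable C, (P i C <= (w / 2)%:E)%E &
     forall y, side y -> 2 * normal_tail (`|y - theta P| / sigma P) <= w -> C y]) ->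
  exists (C : set R) (v : R), [/\ measurable C, 0 <= v, (v%:E * P i C <= (c / 2)%:E)%E &
    forall y, side y -> good y -> C y /\ (N y)%:R^-1 = v].
Proof.
move=> c0 Npos Nconst Nle cover.
have [[y0 [sy0 gy0]]|none] := pselect (exists y, side y /\ good y); last first.
  exists set0, 0; split => //; first by rewrite mul0e lee_fin divr_ge0.
  by move=> y sy gy; case: none; exists y.
have N0 : 0 < (N y0)%:R :> R by rewrite ltr0n Npos.
have [|C [mC PC hC]] := cover (c * (N y0)%:R); first by rewrite mulr_ge0 // ltW.
exists C, (N y0)%:R^-1; split => //.
  apply: (@le_trans _ _ ((N y0)%:R^-1%:E * (c * (N y0)%:R / 2)%:E)%E).
    by apply: lee_wpmul2l => //; rewrite lee_fin invr_ge0 ltW.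
  rewrite -EFinM lee_fin le_eqVlt; apply/orP; left; apply/eqP.
  by field; rewrite gt_eqF.
move=> y sy gy; rewrite (Nconst y y0)//; split => //.
by apply: hC => //; rewrite -(Nconst y y0)//; exact: Nle.
Qed.

Lemma measurable_set_coord i (Y : observation R n) :
  measurable_fun setT (fun x : measurableTypeR R => set_coord i x Y : observation R n).
Proof.
apply/measurable_fun_tnthP => j.
rewrite (_ : _ \o _ = fun x => if j == i then x else tnth Y j); last first.
  by apply/funext => x /=; rewrite tnth_mktuple.
by case: (j == i).
Qed.

Variables (a d X : R).
Hypotheses (a01 : n%:R^-1 < a < 2^-1) (d02 : 0 <= d <= 2^-1).
Hypotheses (loss1 : tail_loss d X < 1) (X0 : 2 * normal_tail X <= n%:R^-1 ^+ 2).
Hypothesis dq : 2 * d <= normal_tail_inv (1 / 4).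
Local Notation kap := (tail_loss d X).

Let a0 : 0 < a.
Proof. by case/andP: a01 => h _; rewrite (le_lt_trans _ h)// invr_ge0. Qed.
Let a02 : 0 < a < 2^-1. Proof. by rewrite a0; case/andP: a01. Qed.
Let a1 : 0 < a <= 1. Proof. by case/andP: a02 => -> h /=; lra. Qed.

Definition accurate_rejection i : set (observation R n) :=
  [set Y | accurate P d Y /\ i \in plugin_BH n a Y].

Lemma measurable_accurate : measurable (accurate P d).
Proof.
apply: measurableI; rewrite -[X in measurable X]setTI; apply: measurable_fun_le => //.
- apply: measurableT_comp => //; apply: measurable_funB => //.
  exact: measurable_theta_est.
- apply: measurableT_comp => //; apply: measurable_funB => //.
  exact: measurable_sigma_est.
Qed.

Lemma measurable_accurate_rejection i : measurable (accurate_rejection i).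
Proof.
apply: measurableI; first exact: measurable_accurate.
exact: (measurable_procedure (fun S => i \in S) (@plugin_BH_procedure R n a a1)).
Qed.

Definition rejection_weight i (Y : observation R n) : R :=
  #|plugin_BH n a Y|%:R^-1 * \1_(accurate_rejection i) Y.

Lemma measurable_rejection_weight i :
  measurable_fun setT (rejection_weight i).
Proof.
apply: measurable_funM; last first.
  by apply: measurable_indic; exact: measurable_accurate_rejection.
exact: (measurable_fun_procedure (fun S => #|S|%:R^-1) (@plugin_BH_procedure R n a a1)).
Qed.

Lemma rejection_weight_ge0 i Y : 0 <= rejection_weight i Y.
Proof. by rewrite mulr_ge0 ?invr_ge0. Qed.

(** Conditionally on the other coordinates the two sides of the center each
    contribute half of the bound. *)
Lemma integral_rejection_weight i : i \in H0 P ->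
  (\int[product_law P]_Y (rejection_weight i Y)%:E <=
   (a / (n%:R * (1 - kap)))%:E)%E.
Proof.
move=> iH.
have n0 : (0 < n)%N := leq_ltn_trans (leq0n _) (ltn_ord i).
have n0' : 0 < n%:R :> R by rewrite ltr0n.
have k1 : 0 < 1 - kap by rewrite subr_gt0.
set c := a / _.
have c0 : 0 <= c by rewrite /c divr_ge0 ?ltW// mulr_gt0.
apply: (@integral_product_law_le_coord _ _ _ _ _ _ i).
- by apply/measurable_EFinP; exact: measurable_rejection_weight.
- by move=> Y; rewrite lee_fin rejection_weight_ge0.
move=> Y; pose Z x : observation R n := set_coord i x Y.
have Zi x : tnth (Z x) i = x by rewrite tnth_mktuple eqxx.
have Zj x j : j != i -> tnth (Z x) j = tnth Y j.
  by move=> ji; rewrite tnth_mktuple (negbTE ji).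
pose good x := accurate_rejection i (Z x).
pose N x := #|plugin_BH n a (Z x)|.
have Npos x : good x -> (0 < N x)%N.
  by move=> [_ h]; apply/card_gt0P; exists i.
have Nle x : good x -> 2 * normal_tail (`|x - theta P| / sigma P) <= c * (N x)%:R.
  move=> [h1 h2]; have := oracle_pvalue_le mP a01 d02 X0 h1 h2; rewrite Zi -/(N x).
  rewrite -ler_pdivlMr// => /le_trans; apply; rewrite le_eqVlt; apply/orP; left.
  by apply/eqP; rewrite /c; field; rewrite !gt_eqF.
have sideE x : good x -> (theta P < x -> theta_est (Z x) < x) /\
    (x <= theta P -> x < theta_est (Z x)).
  by move=> [h1 h2]; have := rejected_side mP a01 d02 dq h1 h2; rewrite Zi.
have same x x' : (theta P < x /\ theta P < x') \/ (x <= theta P /\ x' <= theta P) ->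
    good x -> good x' -> N x = N x'.
  move=> sd gx gx'; have [h1 h2] := sideE _ gx; have [h1' h2'] := sideE _ gx'.
  apply: (@plugin_BH_card_const R n a (Z x) (Z x') i) => //.
  - by move=> j ji; rewrite !Zj.
  - by case: gx.
  - by case: gx'.
  - rewrite !Zi; case: sd => -[s1 s2]; [left|right]; split;
      [exact: h1|exact: h1'|exact: h2|exact: h2'].
have [|||C1 [v1 [mC1 v10 PC1 hC1]]] :=
  @one_sided_weight i (fun x => theta P < x) good N c c0 Npos.
- by move=> x x' sx sx'; apply: same; left.
- by move=> x _; exact: Nle.
- by move=> w; exact: right_pvalue_cover.
have [|||C2 [v2 [mC2 v20 PC2 hC2]]] :=
  @one_sided_weight i (fun x => x <= theta P) good N c c0 Npos.
- by move=> x x' sx sx'; apply: same; right.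
- by move=> x _; exact: Nle.
- by move=> w; exact: left_pvalue_cover.
have m1 : measurable_fun setT (fun x : measurableTypeR R => (v1 * \1_C1 x)%:E).
  by apply/measurable_EFinP; apply: measurable_funM => //; exact: measurable_indic.
have m2 : measurable_fun setT (fun x : measurableTypeR R => (v2 * \1_C2 x)%:E).
  by apply/measurable_EFinP; apply: measurable_funM => //; exact: measurable_indic.
apply: (@le_trans _ _ (\int[P i]_x ((v1 * \1_C1 x)%:E + (v2 * \1_C2 x)%:E))%E).
  apply: ge0_le_integral => //.
  - by move=> x _; rewrite lee_fin rejection_weight_ge0.
  - apply/measurable_EFinP.
    exact: (measurableT_comp (measurable_rejection_weight i) (measurable_set_coord i Y)).
  - exact: emeasurable_funD.
  - move=> x _; rewrite -EFinD lee_fin /rejection_weight -/(Z x) -/(N x).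
    have [gx|ngx] := pselect (good x); last first.
      by rewrite indicE memNset// mulr0 addr_ge0// mulr_ge0.
    rewrite [in leLHS]indicE mem_set// mulr1.
    have [tx|xt] := ltP (theta P) x.
      have [Cx ->] := hC1 x tx gx; rewrite [\1_C1 x]indicE mem_set// mulr1.
      by rewrite lerDl mulr_ge0.
    have [Cx ->] := hC2 x xt gx; rewrite [\1_C2 x]indicE mem_set// mulr1.
    by rewrite lerDr mulr_ge0.
rewrite ge0_integralD//; last 2 first.
- by move=> x _; rewrite lee_fin mulr_ge0.
- by move=> x _; rewrite lee_fin mulr_ge0.
have iE v (C : set R) : 0 <= v -> measurable C ->
    (\int[P i]_x (v * \1_C x)%:E = v%:E * P i C)%E.
  move=> v0 mC; under eq_integral do rewrite EFinM.
  rewrite ge0_integralZl ?lee_fin//.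
    by rewrite integral_indic// setIT.
  by apply/measurable_EFinP; exact: measurable_indic.
rewrite !iE//; apply: le_trans (leeD PC1 PC2) _.
by rewrite -EFinD lee_fin; lra.
Qed.

(** On the accurate event the false discovery proportion is the sum over true
    nulls of the rejection weights. *)
Lemma FDR_plugin_le :
  (FDR P (plugin_BH n a) <= product_law P (~` accurate P d) + (a / (1 - kap))%:E)%E.
Proof.
have k1 : 0 < 1 - kap by rewrite subr_gt0.
have mA := measurableC measurable_accurate.
have mr := @plugin_BH_procedure R n a a1.
rewrite /FDR unlock.
have mI : measurable_fun setT (fun Y : observation R n => (\1_(~` accurate P d) Y : R)%:E).
  by apply/measurable_EFinP; exact: measurable_indic.
have mW i : measurable_fun setT (fun Y : observation R n => (rejection_weight i Y)%:E).
  by apply/measurable_EFinP; exact: measurable_rejection_weight.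
apply: (@le_trans _ _ (\int[product_law P]_Y ((\1_(~` accurate P d) Y : R)%:E +
    \sum_(i <- enum (H0 P)) (rejection_weight i Y)%:E))%E).
  apply: ge0_le_integral => //=.
  - by move=> Y _; rewrite lee_fin FDP_ge0.
  - by apply/measurable_EFinP; exact: (measurable_fun_procedure (FDP P)).
  - apply: emeasurable_funD => //; exact: emeasurable_sum.
  - move=> Y _; rewrite big_enum/= sumEFin -EFinD lee_fin.
    have [acc|nacc] := pselect (accurate P d Y); last first.
      rewrite indicE mem_set// (le_trans (FDP_le1 _ _))// lerDl.
      by apply: sumr_ge0 => i _; exact: rejection_weight_ge0.
    rewrite indicE memNset ?add0r; last by move=> /(_ acc).
    rewrite /FDP -sum1_card natr_sum mulr_suml.
    rewrite (eq_bigl (fun i => (i \in H0 P) && (i \in plugin_BH n a Y))); last first.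
      by move=> i; rewrite finset.in_setI andbC.
    rewrite big_mkcondr/=; apply: ler_sum => i iH; case: ifPn => iS; last exact: rejection_weight_ge0.
    rewrite /rejection_weight indicE mem_set// mulr1 mul1r lef_pV2 ?posrE ?ltr0n ?leq_max ?orbT//.
      by rewrite ler_nat leq_maxl.
    by apply/card_gt0P; exists i.
rewrite ge0_integralD//; last 2 first.
- by move=> Y _; apply: sume_ge0 => i _; rewrite lee_fin rejection_weight_ge0.
- exact: emeasurable_sum.
rewrite integral_indic// setIT leeD2l//.
rewrite ge0_integral_sum//; last first.
  by move=> i Y _; rewrite lee_fin rejection_weight_ge0.
rewrite big_enum/=; apply: (@le_trans _ _ (\sum_(i in H0 P) (a / (n%:R * (1 - kap)))%:E)%E).
  by apply: lee_sum => i iH; exact: integral_rejection_weight.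
rewrite sumEFin lee_fin sumr_const -[leLHS]mulr_natr.
have [n0|n0] := posnP n.
  rewrite (_ : #|H0 P| = 0%N) ?mulr0 ?divr_ge0 ?ltW//.
  by apply/eqP; rewrite -leqn0 -n0 -[X in (_ <= X)%N]card_ord max_card.
have n0' : 0 < n%:R :> R by rewrite ltr0n.
apply: (@le_trans _ _ (a / (n%:R * (1 - kap)) * n%:R)).
  rewrite ler_wpM2l ?divr_ge0 ?mulr_ge0 ?(ltW k1) ?(ltW a0)// ler_nat.
  by rewrite -[X in (_ <= X)%N]card_ord max_card.
by rewrite le_eqVlt; apply/orP; left; apply/eqP; field; rewrite !gt_eqF.
Qed.

End FDR_bound.

(** * Accuracy of the median estimators *)

Section estimator_accuracy.
Context {R : realType} (n : nat).
Implicit Types (Y : observation R n) (i : 'I_n).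

(** If a property holds for half of the coordinates, it holds for half of
    them minus k among the nulls, whatever the distribution of the others. *)
Lemma null_count_ge (P : @marginals R n) (b : 'I_n -> bool) (A : 'I_n -> Prop) (k : R) :
  (uphalf n <= \sum_(i < n) b i)%N -> (forall i, b i -> A i) -> #|H1 P|%:R <= k ->
  n%:R / 2 - k <= \sum_(i in H0 P) (`[< A i >])%:R.
Proof.
move=> hb bA hk.
have h1 : (\sum_(i < n) b i <= \sum_(i in H0 P) `[< A i >] + #|H1 P|)%N.
  rewrite (bigID (mem (H0 P)))/= leq_add//.
    apply: leq_sum => i _; case bi : (b i) => //.
    by have /asboolP -> := bA i bi.
  rewrite -sum1_card [leqRHS](eq_bigl (fun i => i \notin H0 P)); last first.
    by move=> i; rewrite finset.in_setC.
  by apply: leq_sum => i _; case: (b i).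
have h2 : (n <= 2 * (\sum_(i in H0 P) `[< A i >] + #|H1 P|))%N.
  have := leq_trans hb h1; rewrite uphalf_half.
  have := odd_double_half n; lia.
have h3 : n%:R <= 2 * (\sum_(i in H0 P) (`[< A i >])%:R + #|H1 P|%:R) :> R.
  by rewrite -natr_sum -natrD -natrM ler_nat.
move: h3 hk; set x := \sum_(i in _) _; set z := _%:R => h3 hk; lra.
Qed.

Lemma count_median_lt (v : n.-tuple R) (c : R) : (0 < n)%N -> median v < c ->
  (uphalf n <= \sum_(i < n) (tnth v i < c)%R)%N.
Proof.
move=> n0; rewrite ltNge le_median ?size_tuple// -leqNgt count_tuple.
by apply: leq_trans.
Qed.

Lemma count_median_gt (v : n.-tuple R) (c : R) : (0 < n)%N -> c < median v ->
  (uphalf n <= \sum_(i < n) (c < tnth v i)%R)%N.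
Proof.
move=> n0; rewrite ltNge median_le ?size_tuple// -ltnNge count_tuple => h.
have : (\sum_(i < n) (c < tnth v i)%R + \sum_(i < n) (tnth v i <= c)%R = n)%N.
  rewrite -big_split/= -[RHS](card_ord n) -sum1_card; apply: eq_bigr => i _.
  by rewrite ltNge; case: (_ <= c).
have {}h : (\sum_(i < n) (tnth v i <= c)%R < uphalf n)%N by exact: h.
move: h; set x := (\sum_(i < n) (c < _)%R)%N; set y := (\sum_(i < n) (_ <= c)%R)%N.
rewrite uphalf_half; have := odd_double_half n; lia.
Qed.

Variables (P : @marginals R n) (k e : R).
Hypotheses (mP : model P) (n0 : (0 < n)%N) (kP : #|H1 P|%:R <= k).
Local Notation q := (@normal_tail_inv R (1 / 4)).
Hypotheses (e0 : 0 <= e) (e1 : e <= 1) (eq_ : e <= q).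

(** A lower bound for the standard density wherever the estimators can
    fluctuate, so that an error e costs a probability e * density_floor. *)
Definition density_floor : R := normal_density (q + 1).

Let s0 : 0 < sigma P. Proof. exact: sigma_gt0. Qed.
Let q0 : 0 < q. Proof. exact: normal_quartile_gt0. Qed.
Let c0 : 0 < density_floor. Proof. exact: normal_density_gt0. Qed.

Definition left_tail : set R := [set y | y < theta P - e * sigma P].
Definition right_tail : set R := [set y | theta P + e * sigma P < y].
Definition inner_zone : set R := [set y | `|y - theta P| <= sigma P * (q - e)].
Definition outer_zone : set R := [set y | sigma P * (q + e) < `|y - theta P|].

Let dE z : 0 <= z -> z <= q + 1 -> density_floor <= normal_density z.
Proof. by move=> z0 zq; rewrite normal_density_le// z0. Qed.

Let tail_e : normal_tail e <= 2^-1 - e * density_floor.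
Proof.
have := @normal_tail_sub_lb R 0 e; rewrite lexx e0 subr0 normal_tail0 => /(_ isT) h.
have : e * density_floor <= e * normal_density e.
  by rewrite ler_wpM2l// dE// (le_trans e1)// lerDr ltW.
lra.
Qed.

Let tail_qe : normal_tail (q + e) <= 4^-1 - e * density_floor.
Proof.
have := @normal_tail_sub_lb R q (q + e).
rewrite ltW//= lerDl e0 (addrC q) addrK normal_quartile_tail => /(_ isT) h.
have : e * density_floor <= e * normal_density (e + q).
  by rewrite ler_wpM2l// dE ?addr_ge0 ?(ltW q0)// addrC lerD2l.
lra.
Qed.

Let tail_qNe : 4^-1 + e * density_floor <= normal_tail (q - e).
Proof.
have := @normal_tail_sub_lb R (q - e) q.
rewrite subr_ge0 eq_ gerBl e0 opprB addrC subrK normal_quartile_tail => /(_ isT) h.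
have : e * density_floor <= e * normal_density q.
  by rewrite ler_wpM2l// dE//; have := q0; lra.
lra.
Qed.

Lemma measurable_left_tail : measurable left_tail.
Proof.
rewrite (_ : left_tail = `]-oo, (theta P - e * sigma P)[%classic)//.
Qed.

Lemma measurable_right_tail : measurable right_tail.
Proof.
rewrite (_ : right_tail = `](theta P + e * sigma P), +oo[%classic)//.
by apply/seteqP; split => y /=; rewrite in_itv/= andbT.
Qed.

Lemma measurable_inner_zone : measurable inner_zone.
Proof.
rewrite -[X in measurable X]setTI; apply: measurable_fun_le => //.
by apply: measurableT_comp => //; exact: measurable_funB.
Qed.

Lemma measurable_outer_zone : measurable outer_zone.
Proof.
rewrite (_ : outer_zone = ~` ([set: R] `&` [set y | `|y - theta P| <= sigma P * (q + e)])).
  apply: measurableC; apply: measurable_fun_le => //.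
  by apply: measurableT_comp => //; exact: measurable_funB.
by rewrite setTI; apply/seteqP; split => y; rewrite /outer_zone /= ltNge => /negP.
Qed.

Lemma left_tail_prob i : i \in H0 P -> (P i left_tail <= (2^-1 - e * density_floor)%:E)%E.
Proof.
move=> iH; rewrite (H0_law mP)//; last exact: measurable_left_tail.
rewrite (_ : mkset _ = `]-oo, (- e)[%classic).
  by rewrite normal_prob_Nyo normal_tailN lee_fin; have := tail_e; lra.
apply/seteqP; split => z; rewrite /left_tail /= in_itv/=.
  by rewrite ltrD2l -mulNr mulrC ltr_pM2r.
by rewrite ltrD2l -mulNr (mulrC (sigma P)) ltr_pM2r.
Qed.

Lemma right_tail_prob i : i \in H0 P -> (P i right_tail <= (2^-1 - e * density_floor)%:E)%E.
Proof.
move=> iH; rewrite (H0_law mP)//; last exact: measurable_right_tail.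
rewrite (_ : mkset _ = `]e, +oo[%classic).
  by rewrite normal_prob_oy lee_fin.
apply/seteqP; split => z; rewrite /right_tail /= in_itv/= andbT.
  by rewrite ltrD2l (mulrC (sigma P)) ltr_pM2r.
by rewrite ltrD2l (mulrC (sigma P)) ltr_pM2r.
Qed.

Let stdE z : `|theta P + sigma P * z - theta P| = sigma P * `|z|.
Proof. by rewrite addrAC subrr add0r normrM gtr0_norm. Qed.

Let ed0 : 0 <= e * density_floor. Proof. by rewrite mulr_ge0// ltW. Qed.

Lemma inner_zone_prob i : i \in H0 P -> (P i inner_zone <= (2^-1 - e * density_floor)%:E)%E.
Proof.
move=> iH; rewrite (H0_law mP)//; last exact: measurable_inner_zone.
rewrite (_ : mkset _ = ~` [set u : R | q - e < `|u|]); last first.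
  apply/seteqP; split => z; rewrite /inner_zone /= stdE ler_pM2l//.
    by rewrite leNgt => /negP.
  by rewrite leNgt => /negP.
rewrite [leLHS](probability_setC (normal_prob 0 1)); last exact: measurable_two_sided.
rewrite [X in (_ - X)%E]normal_prob_two_sided ?subr_ge0// -EFinB lee_fin.
by have := tail_qNe; have := ed0; lra.
Qed.

Lemma outer_zone_prob i : i \in H0 P -> (P i outer_zone <= (2^-1 - e * density_floor)%:E)%E.
Proof.
move=> iH; rewrite (H0_law mP)//; last exact: measurable_outer_zone.
rewrite (_ : mkset _ = [set u : R | q + e < `|u|]); last first.
  by apply/seteqP; split => z; rewrite /outer_zone /= stdE ltr_pM2l.
rewrite normal_prob_two_sided ?addr_ge0 ?(ltW q0)// lee_fin.
by have := tail_qe; have := ed0; lra.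
Qed.

Definition null_excess (A : set R) : set (observation R n) :=
  [set Y | n%:R / 2 - k <= \sum_(i in H0 P) (`[< A (tnth Y i) >])%:R].

Lemma measurable_null_excess (A : set R) : measurable A -> measurable (null_excess A).
Proof.
move=> mA; rewrite -[X in measurable X]setTI.
rewrite (_ : null_excess A = [set Y | n%:R / 2 - k <=
   \sum_(i <- enum (H0 P)) (`[< A (tnth Y i) >])%:R]); last first.
  by apply/seteqP; split => Y; rewrite /null_excess /= big_enum.
apply: measurable_fun_le => //; apply: measurable_sum => i.
rewrite (_ : (fun Y => _) = fun Y : observation R n => if `[< A (tnth Y i) >] then 1 else 0); last first.
  by apply/funext => Y; case: asboolP.
exact: (measurableT_comp (measurable_fun_if_in 1 0 mA) (measurable_coord i)).
Qed.

(** A median that misses its target by e sigma puts half of the sample in a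
    zone of null probability below 1/2: the left or right tail for the center
    and, once the center is located, the inner or outer zone for the scale.
    The zones are drawn around the true center, at the distances q - e and q
    + e in units of sigma, so that the median absolute deviation is off by at
    most 2 e sigma. *)
Lemma inaccurate_sub : ~` accurate P (e * (1 + 2 / q)) `<=`
  (null_excess left_tail `|` null_excess right_tail) `|`
  (null_excess inner_zone `|` null_excess outer_zone).
Proof.
move=> Y nacc; apply: contrapT => hn; apply: nacc.
have {hn} [[hl hr] [hi ho]] : (~ null_excess left_tail Y /\ ~ null_excess right_tail Y) /\
    (~ null_excess inner_zone Y /\ ~ null_excess outer_zone Y).
  by split; split => h; apply: hn; [left; left|left; right|right; left|right; right].
have t1 : theta P - e * sigma P <= theta_est Y.
  rewrite leNgt; apply/negP => h; apply: hl.
  by apply: (null_count_ge (count_median_lt n0 h)).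
have t2 : theta_est Y <= theta P + e * sigma P.
  rewrite leNgt; apply/negP => h; apply: hr.
  by apply: (null_count_ge (count_median_gt n0 h)).
have tt : `|theta_est Y - theta P| <= e * sigma P.
  by rewrite ler_norml; apply/andP; split; [rewrite lerBrDl|rewrite lerBlDl].
pose f (y : R) := `|y - theta_est Y|.
have madE : median_abs_dev Y = median (map_tuple f Y) by [].
have m1 : sigma P * (q - 2 * e) <= median_abs_dev Y.
  rewrite leNgt madE; apply/negP => h; apply: hi.
  apply: (null_count_ge (count_median_lt n0 h)) => // i; rewrite tnth_map /f /inner_zone /= => hlt.
  have -> : tnth Y i - theta P = (tnth Y i - theta_est Y) + (theta_est Y - theta P).
    by rewrite addrA subrK.
  rewrite (le_trans (ler_normD _ _))// (le_trans (lerD (ltW hlt) tt))//.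
  by rewrite le_eqVlt; apply/orP; left; apply/eqP; ring.
have m2 : median_abs_dev Y <= sigma P * (q + 2 * e).
  rewrite leNgt madE; apply/negP => h; apply: ho.
  apply: (null_count_ge (count_median_gt n0 h)) => // i; rewrite tnth_map /f /outer_zone /= => hlt.
  have h3 : `|tnth Y i - theta_est Y| <= `|tnth Y i - theta P| + e * sigma P.
    have -> : tnth Y i - theta_est Y = (tnth Y i - theta P) - (theta_est Y - theta P).
      by rewrite opprB addrA subrK.
    by rewrite (le_trans (ler_normB _ _))// lerD2l.
  rewrite -(ltrD2r (e * sigma P)) (lt_le_trans _ h3)// (le_lt_trans _ hlt)//.
  by rewrite le_eqVlt; apply/orP; left; apply/eqP; ring.
split.
  rewrite (le_trans tt)// ler_wpM2r ?(ltW s0)// ler_peMr// lerDl divr_ge0// ltW//.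
have sE : sigma_est Y = median_abs_dev Y / q by exact: sigma_estE.
have -> : sigma_est Y - sigma P = (median_abs_dev Y - sigma P * q) / q.
  by rewrite sE; field; rewrite gt_eqF.
rewrite normrM normfV (gtr0_norm q0) ler_pdivrMr//.
apply: (@le_trans _ _ (2 * e * sigma P)).
  by rewrite ler_norml; apply/andP; split; move: m1 m2; rewrite mulrBr mulrDr; lra.
have -> : e * (1 + 2 / q) * sigma P * q = e * sigma P * q + 2 * e * sigma P.
  by field; rewrite gt_eqF.
by rewrite lerDr !mulr_ge0 ?(ltW s0)// ltW.
Qed.

Hypothesis ke : k <= n%:R * (e * density_floor) / 2.
Hypothesis ed2 : e * density_floor <= 2^-1.

Lemma inaccurate_prob :
  (product_law P (~` accurate P (e * (1 + 2 / q))) <=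
   (4 * expR (- (n%:R * (e * density_floor) ^+ 2 / 16)))%:E)%E.
Proof.
set b := expR _.
have cher (A : set R) : measurable A ->
    (forall i, i \in H0 P -> (P i A <= (2^-1 - e * density_floor)%:E)%E) ->
    (product_law P (null_excess A) <= b%:E)%E.
  move=> mA PA; apply: (@chernoff_half _ _ R n P (fun _ => A) (H0 P) _ _ k) => //.
  - by rewrite ed0 ed2.
  - exact: measurable_null_excess.
have mm := measurable_null_excess.
have mL := mm _ measurable_left_tail; have mRt := mm _ measurable_right_tail.
have mIn := mm _ measurable_inner_zone; have mO := mm _ measurable_outer_zone.
apply: (@le_trans _ _ ((b%:E + b%:E) + (b%:E + b%:E))%E); last first.
  by rewrite -!EFinD lee_fin; lra.
apply: (@le_trans _ _ (product_law P ((null_excess left_tail `|` null_excess right_tail) `|`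
  (null_excess inner_zone `|` null_excess outer_zone)))).
  apply: product_law_le; last exact: inaccurate_sub.
    by apply: measurableC; exact: measurable_accurate.
  by apply: measurableU; apply: measurableU.
apply: le_trans (measureU2 _ _ _) _; [exact: measurableU|exact: measurableU|].
have bL := cher _ measurable_left_tail left_tail_prob.
have bR := cher _ measurable_right_tail right_tail_prob.
have bI := cher _ measurable_inner_zone inner_zone_prob.
have bO := cher _ measurable_outer_zone outer_zone_prob.
apply: leeD.
  by apply: le_trans (measureU2 _ mL mRt) _; exact: leeD.
by apply: le_trans (measureU2 _ mIn mO) _; exact: leeD.
Qed.

End estimator_accuracy.

(** * Optimality below the threshold *)

Section optimality.
Context {R : realType}.
Local Notation q := (@normal_tail_inv R (1 / 4)).
Local Notation c := (@density_floor R).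

(** The relative error on center and scale, in units of e, that corresponds
    to an error e on the medians. *)
Definition error_scale : R := 1 + 2 / q.
(** Indexed by n + 1 so as to be positive for all n. *)
Definition root8 (n : nat) : R := Num.sqrt (Num.sqrt (Num.sqrt n.+1%:R)).
(** The first term is what k arbitrary entries can cost; it makes the slack
    of the Chernoff bound at least k.  The second one, of order n ^ (-1/4),
    stays above the fluctuations of order n ^ (-1/2), hence the exponential
    bound vanishes, while being negligible against 1 / ln n.  The absolute
    value makes the error positive for all n. *)
Definition estimation_error (k : nat -> R) n : R :=
  2 / c * (`|k n| / n%:R) + root8 n ^- 2.
(** Two-sided p-values beyond this point are at most 4 n ^ (-4), below all
    the critical levels a m / n, which are at least n ^ (-2) when a > 1 / n. *)
Definition cutoff (n : nat) : R := 4 * Num.sqrt (ln n%:R).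
(** The relative loss of level of the oracle to which the plug-in procedure
    is compared; it vanishes as the estimation error times ln n does. *)
Definition level_loss (k : nat -> R) n : R :=
  tail_loss (estimation_error k n * error_scale) (cutoff n).

Let q0 : 0 < q. Proof. exact: normal_quartile_gt0. Qed.
Let c0 : 0 < c. Proof. exact: normal_density_gt0. Qed.
Let D0 : 0 < error_scale.
Proof. by rewrite addr_gt0// divr_gt0. Qed.

Lemma root8_gt0 n : 0 < root8 n.
Proof. by rewrite !sqrtr_gt0. Qed.

Lemma root8X n : root8 n ^+ 8 = n.+1%:R.
Proof.
rewrite (exprM _ 2 4) sqr_sqrtr ?sqrtr_ge0// (exprM _ 2 2) sqr_sqrtr ?sqrtr_ge0//.
by rewrite sqr_sqrtr.
Qed.

Lemma root8_near (M : R) : \forall n \near \oo, M <= root8 n.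
Proof.
have := @nbhs_infty_ger R (`|M| ^+ 8); apply: filterS => n hn.
rewrite (le_trans (ler_norm M))// -(@ler_pXn2r _ 8)// ?nnegrE ?(ltW (root8_gt0 n))//.
by rewrite root8X (le_trans hn)// ler_nat.
Qed.

Lemma ln_le_root8 n : (0 < n)%N -> ln n%:R <= 8 * root8 n :> R.
Proof.
move=> n0; have r0 := root8_gt0 n.
apply: (@le_trans _ _ (ln (root8 n ^+ 8))).
  by rewrite ler_ln ?posrE ?ltr0n// root8X ?ltr0n// ler_nat.
rewrite lnXn// -[leLHS]mulr_natl ler_pM2l//.
have : ln (1 + (root8 n - 1)) <= root8 n - 1 by apply: le_ln1Dx; lra.
rewrite addrC subrK; lra.
Qed.

Lemma estimation_error_gt0 k n : 0 < estimation_error k n.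
Proof.
apply: ltr_wpDl; last by rewrite invr_gt0 exprn_gt0// root8_gt0.
by rewrite mulr_ge0// divr_ge0// ltW.
Qed.

Lemma level_loss_gt0 k n : 0 < level_loss k n.
Proof.
have x0 : 0 <= cutoff n by rewrite mulr_ge0// sqrtr_ge0.
rewrite mulr_gt0 ?exprn_gt0 ?ltr_pwDl// mulr_gt0 ?expR_gt0// mulr_gt0// mulr_gt0//.
exact: estimation_error_gt0.
Qed.

Lemma cutoff_tail n : (2 < n)%N -> 2 * normal_tail (cutoff n) <= n%:R^-1 ^+ 2.
Proof.
move=> n2; have n0 : 0 < n%:R :> R by rewrite ltr0n (ltn_trans _ n2).
have l0 : 0 <= ln n%:R :> R by rewrite ln_ge0// ler1n (ltn_trans _ n2).
have x0 : 0 <= cutoff n by rewrite mulr_ge0// sqrtr_ge0.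
have := normal_tail_expR x0.
have -> : - cutoff n ^+ 2 / 4 = - (4 * ln n%:R).
  by rewrite /cutoff exprMn sqr_sqrtr//; lra.
rewrite expRN expRM_natl lnK ?posrE// => h.
have h4 : 4 * (n%:R ^+ 4)^-1 <= n%:R^-1 ^+ 2 :> R.
  rewrite (exprM _ 2 2) exprVn; set m := n%:R ^+ 2.
  have m0 : 0 < m by rewrite exprn_gt0.
  have m4 : 4 <= m.
    by rewrite /m -natrX ler_nat (@leq_trans (2 ^ 2))// leq_exp2r// ltnW.
  rewrite expr2 invfM mulrA ler_piMl ?invr_ge0 ?(ltW m0)//.
  by rewrite ler_pdivrMr// mul1r.
lra.
Qed.

Lemma cutoff_sq n : 1 <= ln n%:R :> R -> (1 + cutoff n) ^+ 2 <= 34 * ln n%:R.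
Proof.
move=> l1; have l0 : 0 <= ln n%:R :> R by lra.
have s0 := sqrtr_ge0 (ln n%:R : R); have ss := sqr_sqrtr l0.
have := sqr_ge0 (Num.sqrt (ln n%:R : R) * 4 - 1).
rewrite /cutoff; move: ss s0; set s := Num.sqrt _ => ss s0; nra.
Qed.

(** Here the hypothesis on the sparsity enters: the square of the cutoff is
    of order ln n. *)
Lemma error_cutoff_near k (t : R) : 0 < t ->
  k =o_\oo (fun n : nat => n%:R / ln n%:R : R) ->
  \forall n \near \oo, estimation_error k n * (1 + cutoff n) ^+ 2 <= t.
Proof.
move=> t0 /eqoP hk.
(* With (1 + cutoff) ^ 2 <= 34 ln n, each of the two terms of the error is
   allotted t / 2: 34 * (2 / c) * e = t / 2 here, and 34 * 8 / (544 / t) = t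
   / 2 for the bound ln n <= 8 root8 n. *)
pose e := t * c / 136.
have e0 : 0 < e by rewrite divr_gt0// mulr_gt0.
have hk' := hk e e0; have hr := root8_near (544 / t).
have hl := @nbhs_infty_ger R (expR 1).
near=> n.
have n1 : expR 1 <= n%:R :> R by near: n.
have n0 : 0 < n%:R :> R by apply: lt_le_trans n1; exact: expR_gt0.
have l1 : 1 <= ln n%:R :> R by rewrite -[leLHS]expRK ler_ln ?posrE ?expR_gt0.
have l0 : 0 < ln n%:R :> R by apply: lt_le_trans l1.
have hkn : `|k n| <= e * `|n%:R / ln n%:R| by near: n.
have hrn : 544 / t <= root8 n by near: n.
have r0 := root8_gt0 n.
have lr := @ln_le_root8 n; rewrite -(ltr_nat R) in lr; have {}lr := lr n0.
apply: (@le_trans _ _ (estimation_error k n * (34 * ln n%:R))).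
  by rewrite ler_wpM2l ?cutoff_sq// ltW// estimation_error_gt0.
have h1 : `|k n| / n%:R * ln n%:R <= e.
  move: hkn; rewrite (gtr0_norm (divr_gt0 n0 l0)) mulrA ler_pdivlMr// => h.
  by rewrite mulrAC ler_pdivrMr.
have h2 : root8 n ^- 2 * ln n%:R <= t / 68.
  rewrite mulrC ler_pdivrMr ?exprn_gt0//; apply: (le_trans lr).
  move: hrn; rewrite ler_pdivrMr// => hrn; nra.
have h3 : 2 / c * (`|k n| / n%:R * ln n%:R) <= t / 68.
  apply: (@le_trans _ _ (2 / c * e)); first by rewrite ler_wpM2l// divr_ge0// ltW.
  by rewrite le_eqVlt; apply/orP; left; apply/eqP; rewrite /e; field; rewrite gt_eqF.
move: h2 h3; rewrite /estimation_error.
move: (2 / c) (`|k n| / n%:R) (root8 n ^- 2) (ln n%:R) => A B C L h2 h3; lra.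
Unshelve. all: by end_near. Qed.

(** The exponent is at least a multiple of n * root8 ^ (-4), which is of
    order n ^ (1/2). *)
Lemma accuracy_near (t : R) (k : nat -> R) : 0 < t -> \forall n \near \oo,
  4 * expR (- (n%:R * (estimation_error k n * c) ^+ 2 / 16)) <= t.
Proof.
move=> t0; have hr := root8_near (1 + 128 / (c ^+ 2 * t)).
near=> n.
have rn : 1 + 128 / (c ^+ 2 * t) <= root8 n by near: n.
have n0 : (0 < n)%N by near: n; exists 1%N.
have r0 := root8_gt0 n.
have ct : 0 < c ^+ 2 * t by rewrite mulr_gt0// exprn_gt0.
have r1 : 1 <= root8 n by apply: le_trans rn; rewrite lerDl divr_ge0// ltW.
have er : root8 n ^- 2 <= estimation_error k n.
  by rewrite lerDr mulr_ge0// divr_ge0// ltW.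
have y1 : c ^+ 2 * root8 n / 32 <= n%:R * (estimation_error k n * c) ^+ 2 / 16.
  have h1 : (root8 n ^- 2) ^+ 2 <= estimation_error k n ^+ 2.
    by rewrite lerXn2r ?nnegrE ?invr_ge0 ?exprn_ge0 ?(ltW r0) ?(ltW (estimation_error_gt0 k n)).
  have h2 : root8 n ^+ 8 <= 2 * n%:R.
    by rewrite root8X -natrM ler_nat mul2n -addnn -addn1 leq_add2l.
  have h3 : root8 n <= 2 * n%:R * (root8 n ^- 2) ^+ 2.
    have -> : (root8 n ^- 2) ^+ 2 = (root8 n ^+ 4)^-1 by rewrite exprVn -exprM.
    rewrite ler_pdivlMr ?exprn_gt0// (le_trans _ h2)// -exprS.
    by apply: ler_weXn2l.
  have h4 : root8 n <= 2 * n%:R * estimation_error k n ^+ 2.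
    by rewrite (le_trans h3)// ler_wpM2l// mulr_ge0.
  have h5 : 0 < c ^+ 2 by rewrite exprn_gt0.
  have h6 : c ^+ 2 * root8 n <= c ^+ 2 * (2 * n%:R * estimation_error k n ^+ 2).
    by rewrite ler_pM2l.
  rewrite exprMn; lra.
move: y1; set y := _ / 16 => y1.
have yr : 4 / t <= y.
  apply: le_trans y1; rewrite ler_pdivrMr//.
  have : 128 / (c ^+ 2 * t) <= root8 n by apply: le_trans rn; rewrite lerDr.
  by rewrite ler_pdivrMr// => h; rewrite mulrAC ler_pdivlMr//; lra.
have y0 : 0 < y by apply: lt_le_trans yr; rewrite divr_gt0.
rewrite expRN ler_pdivrMr ?expR_gt0//.
have := expR_ge1Dx y; move: yr; rewrite ler_pdivrMr// => yr ey.
have : t * y <= t * expR y by rewrite ler_pM2l//; lra.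
lra.
Unshelve. all: by end_near. Qed.

(** Both risks are controlled by the probability that the estimators are
    inaccurate, up to the perturbation a / (1 - level_loss) of the level, and
    this holds uniformly in the model and in the level a. *)
Lemma plugin_risks_near (k : nat -> R) (e : R) : sparsity_sequence k -> 0 < e ->
  k =o_\oo (fun n : nat => n%:R / ln n%:R : R) ->
  \forall n \near \oo, forall a : R, n%:R^-1 < a < 2^-1 ->
    (risk_I (plugin_BH n a) (k n) <= (a + e)%R%:E)%E /\
    (0%R%:E <= risk_II (plugin_BH n a) (k n) (a * (1 - level_loss k n))%R <= e%:E)%E.
Proof.
move=> hk e0 ho.
pose b := Num.min 2^-1 (e / 2).
have b0 : 0 < b by rewrite lt_min invr_gt0 ltr0n/= divr_gt0.
have K0 : 0 < 2 * expR 2 * error_scale by rewrite !mulr_gt0// expR_gt0.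
have c20 : 0 < (2 * c)^-1 by rewrite invr_gt0 mulr_gt0.
have D20 : 0 < (2 * error_scale)^-1 by rewrite invr_gt0 mulr_gt0.
have qD0 : 0 < q / (2 * error_scale) by rewrite divr_gt0 ?mulr_gt0.
have bK0 : 0 < b / (2 * expR 2 * error_scale) by rewrite divr_gt0.
have e20 : 0 < e / 2 by rewrite divr_gt0.
(* The estimation error is eventually below each of the thresholds that the
   finite sample bounds require. *)
have near1 := error_cutoff_near ltr01 ho.
have nearq := error_cutoff_near q0 ho.
have nearc := error_cutoff_near c20 ho.
have nearD := error_cutoff_near D20 ho.
have nearqD := error_cutoff_near qD0 ho.
have nearb := error_cutoff_near bK0 ho.
have nearp := accuracy_near k e20.
near=> n.
have n2 : (2 < n)%N by near: n; exists 3%N.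
have n0 : (0 < n)%N by apply: ltn_trans n2.
have n0' : 0 < n%:R :> R by rewrite ltr0n.
have /andP[k1 _] := hk n n2; have k0 : 0 < k n by apply: lt_le_trans k1.
have ee0 := estimation_error_gt0 k n.
have cut0 : 0 <= cutoff n by rewrite mulr_ge0// sqrtr_ge0.
have small t : estimation_error k n * (1 + cutoff n) ^+ 2 <= t -> estimation_error k n <= t.
  apply: le_trans; rewrite ler_peMr ?(ltW ee0)// -[leLHS](expr1n _ 2).
  by rewrite lerXn2r ?nnegrE// ?lerDl// addr_ge0.
have e1 : estimation_error k n <= 1 by apply: small; near: n.
have eq : estimation_error k n <= q by apply: small; near: n.
have ec' : estimation_error k n <= (2 * c)^-1 by apply: small; near: n.
have eD' : estimation_error k n <= (2 * error_scale)^-1 by apply: small; near: n.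
have eqD' : estimation_error k n <= q / (2 * error_scale) by apply: small; near: n.
have kapb' : estimation_error k n * (1 + cutoff n) ^+ 2 <= b / (2 * expR 2 * error_scale) by near: n.
have prob' : 4 * expR (- (n%:R * (estimation_error k n * c) ^+ 2 / 16)) <= e / 2 by near: n.
pose ee := estimation_error k n.
have ec : ee * c <= 2^-1.
  by move: ec'; rewrite -(ler_pM2r c0) => /le_trans; apply; rewrite invfM mulfVK ?gt_eqF.
have eD : ee * error_scale <= 2^-1.
  by move: eD'; rewrite -(ler_pM2r D0) => /le_trans; apply; rewrite invfM mulfVK ?gt_eqF.
have eqD : 2 * (ee * error_scale) <= q.
  move: eqD'; rewrite ler_pdivlMr ?mulr_gt0//; apply: le_trans.
  by rewrite le_eqVlt; apply/orP; left; apply/eqP; rewrite /ee; ring.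
have kapb : level_loss k n <= b.
  move: kapb'; rewrite ler_pdivlMr//; apply: le_trans.
  rewrite /level_loss /tail_loss le_eqVlt; apply/orP; left; apply/eqP.
  by ring.
have prob : 4 * expR (- (n%:R * (ee * c) ^+ 2 / 16)) <= e / 2 by exact: prob'.
have kap0 := level_loss_gt0 k n.
have [kap2 kape] : level_loss k n <= 2^-1 /\ level_loss k n <= e / 2.
  by move: kapb; rewrite le_min => /andP.
have kap1 : level_loss k n < 1 by apply: le_lt_trans kap2 _; rewrite invf_lt1 ?ltr1n.
have X0 := cutoff_tail n2.
have kec : k n <= n%:R * (ee * c) / 2.
  have h : 2 / c * (k n / n%:R) <= ee.
    by rewrite /ee /estimation_error gtr0_norm// lerDl invr_ge0 exprn_ge0// ltW// root8_gt0.
  have h' : n%:R * (2 / c * (k n / n%:R) * c) / 2 = k n.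
    by field; rewrite !gt_eqF.
  rewrite -[leLHS]h' ler_pM2r ?invr_gt0// ler_pM2l// ler_pM2r//.
have d02 : 0 <= ee * error_scale <= 2^-1 by rewrite eD mulr_ge0// ltW.
move=> a a01; have /andP[an a2] := a01.
have a0 : 0 < a by apply: lt_trans an; rewrite invr_gt0.
have inacc (P : @marginals R n) : sparse_model (k n) P ->
    (product_law P (~` accurate P (ee * error_scale)) <= (e / 2)%:E)%E.
  move=> [mP HP]; apply: le_trans (inaccurate_prob mP n0 HP (ltW ee0) e1 eq kec ec) _.
  by rewrite lee_fin.
split.
  apply: ge_ereal_sup => _ [P [mP HP] <-].
  apply: le_trans (FDR_plugin_le mP a01 d02 kap1 X0 eqD) _.
  apply: le_trans (leeD2r _ (inacc P (conj mP HP))) _.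
  rewrite -EFinD lee_fin -/(level_loss k n).
  have : a / (1 - level_loss k n) <= a + e / 2.
    rewrite ler_pdivrMr; last by lra.
    move: kap0 kap2 kape a0 a2 e0; clear; set K := level_loss k n => *; nra.
  lra.
apply/andP; split.
  (* The supremum is nonnegative because the model is inhabited. *)
  have := @sparse_pure_null R n (k n) 0 1 n0 (ltW k0) ltr01.
  set P := (fun _ => _) => sP.
  by apply: le_trans (_ : product_law P _ <= _)%E; last by apply: ereal_sup_ubound; exists P.
apply: ge_ereal_sup => _ [P sP <-].
have kb : 0 < a * (1 - level_loss k n) <= 1.
  move: kap0 kap1 a0 a2; clear; set K := level_loss k n => kap0 kap1 a0 a2.
  apply/andP; split; nra.
apply: (@le_trans _ _ (product_law P (~` accurate P (ee * error_scale)))).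
  apply: product_law_le.
  - apply: (@procedure_pair _ _ (plugin_BH n a) (oracle_BH P (a * (1 - level_loss k n)))
      (fun S S' => TDP P S < TDP P S')).
      by apply: plugin_BH_procedure; rewrite a0 ltW// (lt_trans a2)// invf_lt1 ?ltr1n.
    exact: oracle_BH_procedure.
  - by apply: measurableC; exact: measurable_accurate.
  - move=> Y /= hlt acc; have := TDP_plugin_ge (proj1 sP) a01 d02 kap1 X0 acc.
    by rewrite leNgt hlt.
by apply: le_trans (inacc P sP) _; rewrite lee_fin ler_pdivrMr// ler_peMr ?ler1n// ltW.
Unshelve. all: by end_near. Qed.

Lemma limn_esup_le0 (u : nat -> \bar R) :
  (forall e : R, 0 < e -> \forall n \near \oo, (u n <= e%:E)%E) -> (limn_esup u <= 0)%E.
Proof.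
move=> h; apply/lee_addgt0Pr => e e0; rewrite add0e /limn_esup limf_esupE.
apply: (@le_trans _ _ (ereal_sup [set u x | x in [set n | (u n <= e%:E)%E]])).
  apply: ereal_inf_lbound; exists [set n | (u n <= e%:E)%E] => //.
  exact: h.
by apply: ge_ereal_sup => _ [n hn <-].
Qed.

Lemma cvg0_of_near (u : nat -> \bar R) :
  (forall e : R, 0 < e -> \forall n \near \oo, (0 <= u n <= e%:E)%E) -> u @ \oo --> 0%E.
Proof.
move=> h; apply/fine_cvgP; split.
  apply: filterS (h 1 ltr01) => n /andP[u0 u1].
  by rewrite ge0_fin_numE// (le_lt_trans u1)// ltry.
apply/cvgrPdist_le => e e0; apply: filterS (h e e0) => n /andP[u0 ue].
rewrite sub0r normrN /= ger0_norm ?fine_ge0//.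
by rewrite -lee_fin fineK// ge0_fin_numE// (le_lt_trans ue)// ltry.
Qed.

Lemma cvg0_of_near_le (u : nat -> R) :
  (forall n, 0 < u n) ->
  (forall e : R, 0 < e -> \forall n \near \oo, u n <= e) -> u @ \oo --> 0.
Proof.
move=> u0 h; apply/cvgrPdist_le => e e0; apply: filterS (h e e0) => n ue.
by rewrite sub0r normrN gtr0_norm.
Qed.

Lemma plugin_BH_AMO (k : nat -> R) : sparsity_sequence k ->
  k =o_\oo (fun n : nat => n%:R / ln n%:R : R) -> AMO k (@plugin_BH R).
Proof.
move=> hk ho; split.
  by move=> n a /andP[a0 a1]; apply: plugin_BH_procedure; rewrite a0 ltW.
have near_level : \forall n \near \oo, [set a : R | (n%:R^-1 < a < 2^-1)%R] 4^-1.
  apply: filterS (@nbhs_infty_ger R 5) => n n5.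
  by move: n5; clear => n5; apply/andP; split; rewrite ltf_pV2 ?posrE; lra.
exists (level_loss k); split.
- exact: level_loss_gt0.
- apply: cvg0_of_near_le => [n|e e0]; first exact: level_loss_gt0.
  have K0 : 0 < e / (2 * expR 2 * error_scale).
    by rewrite divr_gt0// !mulr_gt0// expR_gt0.
  apply: filterS (error_cutoff_near K0 ho) => n.
  rewrite ler_pdivlMr; last by rewrite !mulr_gt0// expR_gt0.
  apply: le_trans; rewrite /level_loss /tail_loss le_eqVlt; apply/orP; left; apply/eqP.
  by ring.
- apply: limn_esup_le0 => e e0; apply: filterS (plugin_risks_near hk e0 ho) => n h.
  apply: ge_ereal_sup => _ [a a01 <-]; have [h1 _] := h a a01.
  by rewrite leeBlDl// -EFinD.
- apply: cvg0_of_near => e e0.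
  apply: filterS2 (plugin_risks_near hk e0 ho) near_level => n h a4.
  apply/andP; split.
    have [_ /andP[h1 _]] := h _ a4; apply: (le_trans h1).
    by apply: ereal_sup_ubound; exists (4^-1)%R.
  by apply: ge_ereal_sup => _ [a a01 <-]; have [_ /andP[_]] := h a a01.
Qed.

End optimality.

Theorem theorem2p5 (R : realType) (k : nat -> R) (hk : sparsity_sequence k) :
  ((fun n : nat => n%:R / ln n%:R : R) =o_\oo k ->
   ~ exists r : forall n, R -> observation R n -> {set 'I_n}, AMO k r) /\
  (k =o_\oo (fun n : nat => n%:R / ln n%:R : R) ->
   AMO k (@plugin_BH R)).
Proof. by split; [exact: AMO_impossible|exact: plugin_BH_AMO]. Qed.
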